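(* Let $G$ be a Barnette graph whose faces are properly $3$-colored with colors $\{1,2,3\}$, where the outer face of $G$ is a $3$-face. The following are equivalent: (i) $G$ has a hamiltonian cycle $C$ such that all $2$-faces lie inside $C$, all $3$-faces lie outside $C$ (and $1$-faces may lie on either side); (ii) the reduced graph $H$ obtained from $G$ by contracting the $1$-faces has an $A$-trail; (iii) the reduced graph $H'$ obtained from $G$ by contracting the $2$-faces has a spanning tree of faces all of whose faces are $1$-faces; (iv) the reduced graph $H''$ obtained from $G$ by contracting the $3$-faces has a spanning tree of faces all of whose faces are $1$-faces.
   Context: A Barnette graph is a $3$-connected cubic planar bipartite graph (here with a fixed plane embedding). Such a graph has a proper $3$-face-coloring; faces of color $i$ are called $i$-faces, and the boundaries of the $i$-faces form a facial $2$-factor (a spanning $2$-regular subgraph whose cycles are face boundaries). Contracting the $i$-faces means contracting each boundary cycle of an $i$-face to a single vertex, producing a plane multigraph (the reduced graph) whose faces correspond to the faces of $G$ of the other two colors; these faces retain their colors. An $A$-trail of a $2$-connected eulerian plane graph is an eulerian trail in which any two consecutive edges lie on a common face boundary. Radial graph: for a $2$-connected plane graph $H$ with face set $\mathcal{F}(H)$, $\mathcal{R}(H)$ is the bipartite graph on $V(H)\cup\mathcal{F}(H)$ with $x$ adjacent to face $F$ iff $x$ lies on the boundary of $F$. Spanning tree of faces: if $\mathcal{T}$ is a set of bounded faces of $H$ with pairwise edge-disjoint boundaries covering all vertices, and the subgraph of $\mathcal{R}(H)$ induced by $V(H)\cup\mathcal{T}$ is a tree, then the subgraph $H_{\mathcal{T}}$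 formed by the boundary edges of faces of $\mathcal{T}$ is a spanning tree of faces. *)

(* Defs.v *)
(* Plane graphs are represented as combinatorial maps
   (hypermaps in the style of the Four Colour Theorem development):
   a finite type D of darts with permutations edge, node, face satisfying
   edge (node (face x)) = x.  Vertices = node-orbits, edges = edge-orbits
   (edge is a fixed-point-free involution), faces = face-orbits.  A dart x
   is "at" the vertex of its node-orbit and "on" the face of its face-orbit. *)
From mathcomp Require Import all_boot.
Set Warnings "-notation-overridden".
Set Implicit Arguments.
Unset Strict Implicit.
Unset Printing Implicit Defensive.

Section Maps.
Variable D : finType.

Definition graph_rel (edge node : D -> D) : rel D :=
  fun a b => (b == node a) || (b == edge a).

Definition number_of_vertices (node : D -> D) : nat :=
  #|[set froot node x | x : D]|.

Definition plane_map (edge node face : D -> D) : Prop :=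
  [/\ (forall x, edge (edge x) = x) /\ (forall x, edge x != x),
      injective node /\ injective face,
      (forall x, edge (node (face x)) = x),
      (forall x y, connect (graph_rel edge node) x y) &
      (* Euler formula: V + E + F = #darts + 2 *)
      fcard node (mem (@predT D)) + fcard edge (mem (@predT D))
        + fcard face (mem (@predT D)) = #|D| + 2].

Definition simple_map (edge node : D -> D) : Prop :=
  (forall x, ~~ fconnect node x (edge x)) /\
  (forall x y, fconnect node x y -> fconnect node (edge x) (edge y) -> x = y).

Definition cubic (node : D -> D) : Prop := forall x, order node x = 3.

Definition bipartite (edge node : D -> D) : Prop :=
  exists b : D -> bool, (forall x, b (node x) = b x) /\ (forall x, b (edge x) != b x).

Definition three_connected (edge node : D -> D) : Prop :=
  3 < number_of_vertices node /\
  forall x1 x2 : D,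
    let X := fun z => fconnect node x1 z || fconnect node x2 z in
    forall y z, ~~ X y -> ~~ X z ->
      connect (fun a b => [&& ~~ X a, ~~ X b & graph_rel edge node a b]) y z.

Definition barnette (edge node face : D -> D) : Prop :=
  [/\ plane_map edge node face, simple_map edge node, cubic node,
      bipartite edge node & three_connected edge node].

Definition face_3_coloring (edge face : D -> D) (col : D -> nat) : Prop :=
  [/\ (forall x, col x \in [:: 1; 2; 3]), (forall x, col (face x) = col x) &
      (forall x, col (edge x) != col x)].

(* a hamiltonian cycle given by the cyclic sequence of its darts:
   consecutive darts x, y satisfy that y leaves the vertex at which x ends;
   every vertex is visited exactly once. *)
Definition ham_cycle (edge node : D -> D) (s : seq D) : Prop :=
  [/\ 3 <= size s, uniq [seq froot node x | x <- s],
      (forall y, froot node y \in [seq froot node x | x <- s]) &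
      cycle (fun x y => fconnect node (edge x) y) s].

Definition in_cycle (edge : D -> D) (s : seq D) (x : D) : bool :=
  (x \in s) || (edge x \in s).

(* faces reachable from the face of dart o without crossing an edge of the
   cycle lie on the same side as o *)
Definition same_side (edge face : D -> D) (s : seq D) (o x : D) : bool :=
  connect (fun a b => (b == face a) || ((b == edge a) && ~~ in_cycle edge s a)) o x.

Definition skip (g : D -> D) (p : pred D) (x : D) : D :=
  let s := traject g (g x) (order g x) in nth x s (find p s).

(* darts of the reduced map: darts of edges not on the boundary of an i-face *)
Definition keepc (edge : D -> D) (col : D -> nat) (i : nat) : pred D :=
  fun x => (col x != i) && (col (edge x) != i).

(* contracting every i-face boundary removes those darts; the face
   permutation skips them and the node permutation is determined by
   edge' (node' (face' x)) = x. *)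
Definition red_face (edge face : D -> D) (col : D -> nat) (i : nat) : D -> D :=
  skip face (keepc edge col i).

Definition red_node (edge face : D -> D) (col : D -> nat) (i : nat) : D -> D :=
  fun y => edge (skip (finv face) (keepc edge col i) y).

(* a map on the darts satisfying [keep] with permutations edge, nodeH, faceH *)
Definition on_common_face (keep : pred D) (edge faceH : D -> D) (a b : D) : bool :=
  [exists z, [&& keep z, fconnect faceH z a || fconnect faceH z (edge a) &
                 fconnect faceH z b || fconnect faceH z (edge b)]].

Definition A_trail (keep : pred D) (edge nodeH faceH : D -> D) (s : seq D) : Prop :=
  [/\ all keep s,
      (forall x, keep x -> count (fun y => (y == x) || (y == edge x)) s = 1),
      cycle (fun a b => fconnect nodeH (edge a) b) s &
      cycle (on_common_face keep edge faceH) s].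

Definition orbit_set (g : D -> D) (x : D) : {set D} := [set y | fconnect g x y].

Definition is_tree (V : finType) (P : {set V}) (r : rel V) : Prop :=
  P != set0 /\
  (forall x y, x \in P -> y \in P ->
     connect (fun a b => [&& a \in P, b \in P & r a b]) x y) /\
  (forall s : seq V, uniq s -> {subset s <= P} -> 3 <= size s -> ~~ cycle r s).

(* radial graph: vertices (false, vertex orbit), faces (true, face orbit);
   a vertex is adjacent to a face iff it lies on its boundary (they share a dart) *)
Definition radial_rel : rel (bool * {set D}) :=
  fun u v => (u.1 != v.1) && (u.2 :&: v.2 != set0).

Definition spanning_tree_of_faces (keep : pred D) (edge nodeH faceH : D -> D)
    (T : {set D}) : Prop :=
  [/\ {subset T <= keep},
      (forall x, x \in T -> faceH x \in T),
      (* pairwise edge-disjoint boundaries *)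
      (forall x, x \in T -> edge x \in T -> fconnect faceH x (edge x)),
      (forall y, keep y -> exists2 z, fconnect nodeH y z & z \in T) &
      is_tree [set v : bool * {set D} |
                 if v.1 then [exists x in T, v.2 == orbit_set faceH x]
                 else [exists x, keep x && (v.2 == orbit_set nodeH x)]]
              radial_rel].

End Maps.

(* Main.v *)
(* Fix which 1-faces go with the 2-faces (side A); the others go with the
   3-faces (side B).  At every vertex exactly two edges separate A from B, so
   these edges form a 2-factor.  Each of (i)-(iv) says that, for some choice of
   A, this 2-factor is a single cycle: (i) directly; (ii) because the cycle uses
   every edge between a 2-face and a 3-face and passes along each 1-face either
   always beside 2-faces or always beside 3-faces; (iii) because the boundary is
   a single cycle iff the faces of A form a tree in the dual graph; (iv) by the
   same argument for B.

   If A is a tree, composing the face permutation with the transpositions of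
   the dual edges of A merges two cycles at each step, which leaves one boundary
   cycle.  Conversely, one boundary cycle makes both sides connected, and Euler's
   formula leaves just enough dual edges for two trees.

   The A-trail and radial graph conditions only see which faces meet, so
   one needs that two faces share at most one edge.  Deleting two shared edges
   keeps the number of faces; by the genus inequality (again a count of cycles
   under transpositions) this disconnects the map, against 3-connectivity. *)
Require Import Defs.
From mathcomp Require Import all_boot fingroup perm zify.

Set Implicit Arguments.
Unset Strict Implicit.
Unset Printing Implicit Defensive.

Lemma connect_invariant (T : finType) (r : rel T) (P : T -> bool) :
  (forall a b, r a b -> P a = P b) -> forall a b, connect r a b -> P a = P b.
Proof.
move=> H a b /connectP[p]; elim: p a => [|c p IH] a /= ; first by move=> _ ->.
by case/andP=> /H -> pth lst; apply: IH.
Qed.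

(** * Products of a permutation with edge transpositions *)

Section Transpositions.
Variable D : finType.
Implicit Types p q w : {perm D}.

Lemma mem_porbitE w x y : (y \in porbit w x) = fconnect w x y.
Proof.
apply/porbitP/idP => [[i ->]|/iter_findex <-].
  by rewrite permX fconnect_iter.
by exists (findex w x y); rewrite permX.
Qed.

Lemma card_porbits w : #|porbits w| = fcard w (mem (@predT D)).
Proof.
have sw := fconnect_sym (@perm_inj _ w).
rewrite /n_comp_mem.
have -> : porbits w = [set porbit w x | x in froots w].
  apply/setP => X; apply/imsetP/imsetP => [[x _ ->]|[x _ ->]]; last by exists x.
  exists (froot w x); first exact: (roots_root sw).
  by apply/eqP; rewrite eq_porbit_mem porbit_sym mem_porbitE connect_root.
rewrite card_in_imset; first by apply: eq_card => x; rewrite !inE andbT.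
move=> x y /eqP rx /eqP ry /eqP; rewrite eq_porbit_mem mem_porbitE sw => xy.
by rewrite -rx -ry; apply/(rootP sw).
Qed.

Lemma fcard_perm (g : D -> D) (g_inj : injective g) :
  fcard g (mem (@predT D)) = #|porbits (perm g_inj)|.
Proof. by rewrite card_porbits; apply: eq_fcard => x; rewrite permE. Qed.

(** A transposition splits one cycle or merges two; the doubled boolean records both cases without
    subtraction. *)
Lemma card_porbits_tperm w x y : x != y ->
  #|porbits (tperm x y * w)| + (~~ fconnect w x y).*2 = #|porbits w|.+1.
Proof.
move=> xy; have := porbits_mul_tperm w x y => /=.
by rewrite xy mem_porbitE (fconnect_sym (@perm_inj _ w)) addn1.
Qed.

(** The new cycle of [x] starts with [w y] and then follows the old cycle of [y], which avoids [x],
    up to [y] itself; so the two cycles become one. *)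
Lemma fconnect_tperm_merge w x y : ~~ fconnect w x y ->
  fconnect (tperm x y * w)%g x y /\
  subrel (fconnect w) (fconnect (tperm x y * w)%g).
Proof.
move=> nxy; set w' := (tperm x y * w)%g.
have s' := fconnect_sym (@perm_inj _ w').
have sw := fconnect_sym (@perm_inj _ w).
have w'x : w' x = w y by rewrite permM tpermL.
have w'y : w' y = w x by rewrite permM tpermR.
have w'z z : x != z -> y != z -> w' z = w z by move=> *; rewrite permM tpermD.
have orb_y i : fconnect w' x (iter i w (w y)).
  elim: i => [|i IH] /=; first by rewrite -w'x fconnect1.
  set u := iter i w (w y) in IH *.
  have [->|yu] := eqVneq u y; first by rewrite -w'x fconnect1.
  have xu : x != u.
    apply: contraNneq nxy => ->.
    by rewrite sw /u -iterSr fconnect_iter.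
  rewrite eq_sym in yu.
  by rewrite -(w'z u) // -(same_fconnect1_r (@perm_inj _ w')).
have xy : fconnect w' x y.
  have : fconnect w (w y) y by rewrite sw fconnect1.
  by move/iter_findex=> <-; apply: orb_y.
split=> //; apply: connect_sub => z u /eqP <-.
have [<-|xz] := eqVneq x z.
  by apply: connect_trans xy _; rewrite -w'y fconnect1.
have [<-|yz] := eqVneq y z; last by rewrite -w'z // fconnect1.
by rewrite s' in xy; apply: connect_trans xy _; rewrite -w'x fconnect1.
Qed.

Variable e : D -> D.
Hypothesis e_inv : forall x, e (e x) = x.
Hypothesis e_fix : forall x, e x != x.

Definition swap_edges (ts : seq D) : {perm D} :=
  (\prod_(x <- ts) tperm x (e x))%g.

(** One dart for each chosen edge, which makes the transpositions disjoint. *)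
Definition edge_selection (ts : seq D) : bool :=
  uniq ts && all (fun x => e x \notin ts) ts.

Lemma edge_selection_cons t ts : edge_selection (t :: ts) ->
  [/\ edge_selection ts, t \notin ts & e t \notin ts].
Proof.
case/andP=> /= /andP[tts uts] /andP[]; rewrite inE negb_or => /andP[_ ett] h.
split=> //; rewrite /edge_selection uts /=; apply: sub_all h => x.
by rewrite inE negb_or => /andP[].
Qed.

Lemma swap_edgesE ts x : edge_selection ts ->
  swap_edges ts x = if (x \in ts) || (e x \in ts) then e x else x.
Proof.
rewrite /swap_edges; elim: ts x => [|t ts IH] x; first by rewrite big_nil perm1.
case/edge_selection_cons=> /IH{}IH tts ets; rewrite big_cons permM IH !inE.
have [->|xt] := eqVneq x t.
  by rewrite tpermL e_inv (negPf tts) (negPf ets).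
have [ext|ext] := eqVneq (e x) t.
  have -> : x = e t by rewrite -ext e_inv.
  by rewrite tpermR e_inv (negPf tts) (negPf ets) orbT.
rewrite tpermD // 1?eq_sym //.
by apply: contraNneq ext => ->; rewrite e_inv.
Qed.

Definition edge_step (p : D -> D) (ts : seq D) : rel D :=
  fun a b => (b == p a) || (b == e a) && ((a \in ts) || (e a \in ts)).

(** The edge of [z] is not crossed; whether [z] still reaches [e z] tests for a bridge. *)
Definition edge_step_without (z : D) (p : D -> D) (ts : seq D) : rel D :=
  fun a b => (b == p a) ||
    [&& b == e a, (a \in ts) || (e a \in ts), a != z & a != e z].

Lemma swap_edges_connect p ts : edge_selection ts ->
  subrel (fconnect (swap_edges ts * p)%g) (connect (edge_step p ts)).
Proof.
move=> sel; apply: connect_sub => a b /eqP <-; rewrite permM swap_edgesE //.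
case: ifP => h; last by apply: connect1; rewrite /edge_step eqxx.
apply: (@connect_trans _ _ (e a)); apply: connect1; rewrite /edge_step eqxx ?orbT //.
by rewrite h orbT.
Qed.

(* Along a forest every transposition merges two cycles, so the final cycles
   are the connected components. *)
Lemma swap_forest p ts : edge_selection ts ->
  (forall z, z \in ts -> ~~ connect (edge_step_without z p ts) z (e z)) ->
  subrel (connect (edge_step p ts)) (fconnect (swap_edges ts * p)%g).
Proof.
elim: ts => [|t ts IH] sel bridge.
  apply: connect_sub => a b; rewrite /edge_step !in_nil andbF orbF => /eqP ->.
  by rewrite /swap_edges big_nil mul1g fconnect1.
have [sel' tts ets] := edge_selection_cons sel.
have sub_ts a : (a \in ts) || (e a \in ts) ->
    [&& (a \in t :: ts) || (e a \in t :: ts), a != t & a != e t].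
  move=> h; rewrite !inE orbACA h orbT /=; apply/andP; split.
    by apply: contraTneq h => ->; rewrite negb_or tts.
  by apply: contraTneq h => ->; rewrite negb_or e_inv ets tts.
have {}IH : subrel (connect (edge_step p ts)) (fconnect (swap_edges ts * p)%g).
  apply: IH => // z zts; apply: contra (bridge z _); last by rewrite inE zts orbT.
  apply: connect_sub => a b h; apply: connect1; move: h.
  rewrite /edge_step_without => /orP[->//|/and4P[-> h -> ->]].
  by case/and3P: (sub_ts _ h) => -> _ _; rewrite orbT.
rewrite /swap_edges big_cons -mulgA -/(swap_edges ts).
(* The cycles of the shorter product stay inside the components left without the edge of [t], which
   is a bridge; so this transposition merges. *)
have [ |tet sub] := @fconnect_tperm_merge (swap_edges ts * p)%g t (e t).
  apply: contra (bridge t (mem_head _ _)) => /(swap_edges_connect sel').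
  apply: connect_sub => a b h; apply: connect1; move: h.
  rewrite /edge_step /edge_step_without => /orP[->//|/andP[-> /sub_ts ->]].
  by rewrite orbT.
set w' := (tperm _ _ * _)%g in tet sub *.
have sw := fconnect_sym (@perm_inj _ w').
apply: connect_sub => a b /orP[/eqP->|/andP[/eqP->]].
  by apply/sub/IH/connect1; rewrite /edge_step eqxx.
rewrite !inE orbACA => /orP[/orP[/eqP->|/eqP ta]|h]; first by [].
  by rewrite sw ta -[a]e_inv ta.
by apply/sub/IH/connect1; rewrite /edge_step eqxx h orbT.
Qed.

(* [w] has the connected components as its cycles; the last inequality is the
   nonnegativity of the genus. *)
Lemma swap_genus p ts : edge_selection ts -> exists w,
  [/\ subrel (connect (edge_step p ts)) (fconnect w),
      #|porbits p| <= size ts + #|porbits w| &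
      #|porbits (swap_edges ts * p)| + #|porbits p| <=
        size ts + #|porbits w|.*2].
Proof.
elim: ts => [|t ts IH] sel.
  exists p; rewrite /swap_edges big_nil mul1g -addnn add0n; split=> //.
  apply: connect_sub => a b; rewrite /edge_step !in_nil andbF orbF => /eqP ->.
  exact: fconnect1.
have [sel' tts ets] := edge_selection_cons sel.
have [w [sub le1 le2]] := IH sel'.
rewrite /swap_edges big_cons -mulgA -/(swap_edges ts).
set q := (swap_edges ts * p)%g in le2 *.
have tet : t != e t by rewrite eq_sym.
have stepP w' : fconnect w' t (e t) -> subrel (fconnect w) (fconnect w') ->
    subrel (connect (edge_step p (t :: ts))) (fconnect w').
  have sw := fconnect_sym (@perm_inj _ w').
  move=> ht sub'; apply: connect_sub => a b /orP[/eqP->|/andP[/eqP->]].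
    by apply/sub'/sub/connect1; rewrite /edge_step eqxx.
  rewrite !inE orbACA => /orP[/orP[/eqP->|/eqP ta]|h]; first by [].
    by rewrite sw ta -[a]e_inv ta.
  by apply/sub'/sub/connect1; rewrite /edge_step eqxx h orbT.
have Cq := card_porbits_tperm q tet.
(* If [t] and [e t] are already joined, [w] stays and the product gains at most one cycle. Otherwise
   [w] and [q] both lose one, because the cycles of [q] lie inside those of [w]. *)
have [hw|hw] := boolP (fconnect w t (e t)).
  exists w; split=> /=; first exact: stepP.
    by rewrite addSn; apply: leqW.
  move: le2 Cq; case: (fconnect q _ _) => /=;
    move: #|porbits q| #|porbits p| #|porbits w| #|porbits (_ * q)|; lia.
exists (tperm t (e t) * w)%g.
have [h1 h2] := fconnect_tperm_merge hw.
have hq : ~~ fconnect q t (e t).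
  by apply: contra hw => /(swap_edges_connect sel')/sub.
have Cw := card_porbits_tperm w tet.
rewrite hq in Cq; rewrite hw in Cw; split=> /=; first exact: stepP;
  move: le1 le2 Cq Cw; move: #|porbits q| #|porbits p| #|porbits w|;
  move: #|porbits (_ * q)| #|porbits (_ * w)|; lia.
Qed.

End Transpositions.

(** * Choosing one dart of each edge *)

Section EdgeLists.
Variables (D : finType) (e : D -> D).
Hypothesis e_inv : forall x, e (e x) = x.
Hypothesis e_fix : forall x, e x != x.

Let e_inj : injective e := can_inj e_inv.

Definition edge_rep : pred D := fun x => enum_rank x < enum_rank (e x).

Lemma edge_rep_edge x : edge_rep (e x) = ~~ edge_rep x.
Proof.
rewrite /edge_rep e_inv; case: ltngtP => // /ord_inj/enum_rank_inj exx.
by have := e_fix x; rewrite exx eqxx.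
Qed.

Definition edge_list (P : pred D) : seq D := [seq x <- enum D | edge_rep x && P x].

Lemma mem_edge_list P x : (x \in edge_list P) = edge_rep x && P x.
Proof. by rewrite mem_filter mem_enum andbT. Qed.

Lemma edge_list_selection P : edge_selection e (edge_list P).
Proof.
rewrite /edge_selection filter_uniq ?enum_uniq //=; apply/allP => x.
by rewrite !mem_edge_list edge_rep_edge => /andP[->].
Qed.

Lemma edge_listP (P : pred D) x : (forall y, P (e y) = P y) ->
  (x \in edge_list P) || (e x \in edge_list P) = P x.
Proof.
by move=> Pe; rewrite !mem_edge_list edge_rep_edge Pe -andb_orl orbN.
Qed.

Lemma size_edge_list (P : pred D) : (forall y, P (e y) = P y) ->
  (size (edge_list P)).*2 = #|[pred x | P x]|.
Proof.
move=> Pe; have -> : size (edge_list P) = \sum_(x | P x && edge_rep x) 1.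
  rewrite sum1_card size_filter cardE enumT size_filter.
  by apply: eq_count => x; rewrite /= unfold_in /= andbC.
rewrite -addnn -[RHS]sum1_card [RHS](bigID edge_rep) /=; congr (_ + _).
rewrite (reindex_inj e_inj); apply: eq_bigl => x.
by rewrite Pe edge_rep_edge.
Qed.
End EdgeLists.

Lemma connect_sym_steps (T : finType) (r : rel T) :
  (forall a b, r a b -> connect r b a) -> connect_sym r.
Proof.
move=> H; suff sub a b : connect r a b -> connect r b a.
  by move=> a b; apply/idP/idP; apply: sub.
case/connectP=> p; elim: p a => [|c p IH] a /=; first by move=> _ ->.
by case/andP=> /H ca pth lst; apply: connect_trans (IH _ pth lst) ca.
Qed.

(** * Sides of a cubic map and their boundary *)

Section CubicMap.
Variables (D : finType) (e n f : D -> D).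
Hypothesis e_inv : forall x, e (e x) = x.
Hypothesis e_fix : forall x, e x != x.
Hypothesis n_cub : forall x, n (n (n x)) = x.
Hypothesis fE : forall x, f x = n (n (e x)).

Lemma edge_inj : injective e. Proof. exact: can_inj e_inv. Qed.

Lemma node_inj : injective n.
Proof. by move=> x y nxy; rewrite -[x]n_cub nxy n_cub. Qed.

Lemma face_inj : injective f.
Proof. by move=> x y; rewrite !fE => /node_inj/node_inj/edge_inj. Qed.

Lemma face_edge x : f (e x) = n (n x). Proof. by rewrite fE e_inv. Qed.

Lemma node_face x : n (f x) = e x. Proof. by rewrite fE n_cub. Qed.

(* Its connected components are those of the dual graph restricted to the
   edges satisfying [P]. *)
Definition dual_step (P : pred D) : rel D :=
  fun a b => (b == f a) || (b == e a) && P a.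

Lemma fconnect_dual_step P : subrel (fconnect f) (connect (dual_step P)).
Proof. by apply: connect_sub => a b /eqP <-; apply: connect1; rewrite /dual_step eqxx. Qed.

Lemma dual_step_sym P : (forall x, P (e x) = P x) -> connect_sym (dual_step P).
Proof.
move=> Pe; apply: connect_sym_steps => a b /orP[/eqP->|/andP[/eqP-> Pa]].
  by apply: fconnect_dual_step; rewrite (fconnect_sym face_inj) fconnect1.
by apply: connect1; rewrite /dual_step e_inv eqxx Pe Pa orbT.
Qed.

Section Cut.
Variable A : pred D.
Hypothesis A_face : forall x, A (f x) = A x.
Hypothesis A_cut : forall x, ~~ ((A x == A (n x)) && (A (n x) == A (n (n x)))).

Definition cutting : pred D := fun x => A x != A (e x).

Lemma A_edge x : A (e x) = A (n (n x)).
Proof. by rewrite -face_edge A_face. Qed.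

Lemma cutting_edge x : cutting (e x) = cutting x.
Proof. by rewrite /cutting e_inv eq_sym. Qed.

(* The successor along the 2-factor of cut edges, keeping the same side on the
   left; the identity off this 2-factor. *)
Definition boundary_next (x : D) : D :=
  if cutting x then if cutting (f x) then f x else f (e (f x)) else x.

(** An uncut edge is stepped over: [f (e x)] is [n (n x)], at the same vertex, on the same side, and
    cut. *)
Definition to_cutting (x : D) : D := if cutting x then x else f (e x).

Lemma cutting_to x : cutting (to_cutting x).
Proof.
rewrite /to_cutting; case: ifPn => //; rewrite /cutting face_edge !A_edge !n_cub.
by have := A_cut x; do 3![case: (A _)].
Qed.

Lemma A_to_cutting x : A (to_cutting x) = A x.
Proof. by rewrite /to_cutting; case: ifPn => //; rewrite /cutting A_face negbK => /eqP. Qed.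

Lemma boundary_nextE x : cutting x -> boundary_next x = to_cutting (f x).
Proof. by rewrite /boundary_next => ->. Qed.

Lemma A_boundary_next x : A (boundary_next x) = A x.
Proof.
have [Kx|nKx] := boolP (cutting x); last by rewrite /boundary_next (negPf nKx).
by rewrite boundary_nextE // A_to_cutting A_face.
Qed.

Lemma cutting_boundary_next x : cutting (boundary_next x) = cutting x.
Proof.
have [Kx|nKx] := boolP (cutting x); first by rewrite boundary_nextE // cutting_to.
by rewrite /boundary_next (negPf nKx) (negPf nKx).
Qed.

Lemma boundary_next_inj : injective boundary_next.
Proof.
move=> x y xy.
have Kxy : cutting x = cutting y by rewrite -cutting_boundary_next xy cutting_boundary_next.
move: xy; rewrite /boundary_next -Kxy; case: ifP => // Kx.
have Ky : cutting y by rewrite -Kxy.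
case: ifPn => Kfx; case: ifPn => Kfy /face_inj.
- by [].
- by move=> xfy; move: Kx; rewrite xfy cutting_edge (negPf Kfy).
- by move=> xfy; move: Ky; rewrite -xfy cutting_edge (negPf Kfx).
- by move/edge_inj/face_inj.
Qed.

(** [boundary_next] preserves the side, and the opposite darts trace the boundary again from the
    other side; hence the restriction to [A]. *)
Definition single_boundary : Prop := forall x y,
  A x -> A y -> cutting x -> cutting y -> fconnect boundary_next x y.

Definition uncut : pred D := fun x => ~~ cutting x.
Definition uncut_without (z : D) : pred D :=
  fun x => [&& ~~ cutting x, x != z & x != e z].

Lemma uncut_edge x : uncut (e x) = uncut x.
Proof. by rewrite /uncut cutting_edge. Qed.

Lemma uncut_without_edge z x : uncut_without z (e x) = uncut_without z x.
Proof.
rewrite /uncut_without cutting_edge (inj_eq edge_inj) (can2_eq e_inv e_inv).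
by rewrite [(x != e z) && _]andbC.
Qed.

(* Acyclicity of the dual graph of [A] is stated as: every edge is a bridge. *)
Definition face_tree : Prop :=
  (forall x y, A x -> A y -> connect (dual_step uncut) x y) /\
  (forall z, A z -> uncut z -> ~~ connect (dual_step (uncut_without z)) z (e z)).

Lemma A_dual_step a b : dual_step uncut a b -> A a = A b.
Proof.
case/orP=> [/eqP->|/andP[/eqP-> ]]; first by rewrite A_face.
by rewrite /uncut negbK => /eqP.
Qed.

Lemma dual_step_to_cutting x : connect (dual_step uncut) x (to_cutting x).
Proof.
rewrite /to_cutting; case: ifPn => // nKx.
apply: (@connect_trans _ _ (e x)); apply: connect1; rewrite /dual_step eqxx //.
by rewrite /uncut nKx orbT.
Qed.

(** Composing [f] with the swaps of the uncut edges of [A] gives [q], which follows the faces of [A]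
    and changes face at each uncut edge. For a tree it is a single cycle on [A], and leaving out its
    uncut darts yields [boundary_next]. *)
Lemma face_tree_single : face_tree -> single_boundary.
Proof.
case=> conn bridge x y Ax Ay Kx Ky.
pose P : pred D := fun x => A x && uncut x.
have Pe z : P (e z) = P z.
  rewrite /P uncut_edge; case: (boolP (uncut z)); rewrite ?andbF // !andbT.
  by rewrite /uncut negbK => /eqP.
pose p := perm face_inj; pose ts := edge_list e P.
have sel : edge_selection e ts by apply: edge_list_selection.
have tsP z : (z \in ts) || (e z \in ts) = P z by apply: edge_listP.
have bridge' z : z \in ts -> ~~ connect (edge_step_without e z p ts) z (e z).
  rewrite mem_edge_list => /and3P[_ Az uz]; apply: contra (bridge z Az uz).
  apply: connect_sub => a b; rewrite /edge_step_without tsP permE => h.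
  apply: connect1; rewrite /dual_step; case/orP: h => [->//|].
  by case/and4P=> -> /andP[_ nK] az aez; rewrite /uncut_without -/(uncut a) nK az aez orbT.
have stepA a b : connect (dual_step uncut) a b -> A a -> connect (edge_step e p ts) a b.
  case/connectP=> s; elim: s a => [|c s IH] a /=; first by move=> _ -> .
  case/andP=> ac pth lst Aa; have Ac : A c by rewrite -(A_dual_step ac).
  apply: connect_trans (IH _ pth lst Ac); apply: connect1.
  case/orP: ac => [/eqP->|/andP[/eqP-> ua]]; first by rewrite /edge_step permE eqxx.
  by rewrite /edge_step tsP /P Aa ua eqxx orbT.
have {bridge'} := swap_forest e_inv sel bridge' (stepA _ _ (conn x y Ax Ay) Ax).
set q := (_ * p)%g => /iter_findex; move: (findex _ _ _) => k qxy.
have qE z : q z = if P z then f (e z) else f z.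
  by rewrite permM swap_edgesE // tsP permE; case: ifP.
suff /(_ k)[] i : A (iter i q x) /\ fconnect boundary_next x (to_cutting (iter i q x)).
  by rewrite qxy /to_cutting Ky.
elim: i => [|i [Az IH]] /=; first by rewrite /to_cutting Kx.
move: (iter i q x) Az IH => z Az; rewrite qE /P Az /= /uncut.
have [Kz|nKz] := boolP (cutting z) => /= h.
  split; first by rewrite A_face.
  rewrite -boundary_nextE // -(same_fconnect1_r boundary_next_inj).
  by move: h; rewrite /to_cutting Kz.
have tz : f (e z) = to_cutting z by rewrite /to_cutting (negPf nKz).
rewrite tz A_to_cutting; split=> //.
by rewrite [in to_cutting (to_cutting z)]/to_cutting cutting_to.
Qed.

(** The faces across two successive boundary edges are equal or separated by the third edge at the
    vertex between them, which is uncut; so the boundary walk connects the opposite side as well. *)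
Lemma dual_step_boundary z : cutting z ->
  connect (dual_step uncut) (e z) (e (boundary_next z)).
Proof.
have s := dual_step_sym uncut_edge.
have fstep u : connect (dual_step uncut) u (f u).
  by apply: connect1; rewrite /dual_step eqxx.
move=> Kz; rewrite boundary_nextE // -node_face s; set y := f z.
have e3 : f (e (n (n y))) = n y by rewrite face_edge n_cub.
rewrite /to_cutting; case: ifPn => Ky; last first.
  by rewrite -e3 face_edge fstep.
apply: connect_trans (fstep _) _; rewrite face_edge.
apply: (@connect_trans _ _ (e (n (n y)))); last by rewrite -{2}e3 fstep.
apply: connect1; rewrite /dual_step eqxx /uncut /cutting A_edge n_cub.
move: Kz Ky; rewrite /cutting -(A_face z) -/y [A (e y)]A_edge -(node_face z) -/y.
by do 3![case: (A _)]; rewrite ?orbT.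
Qed.

(** Every vertex has exactly one uncut edge. Summing over the rotations by [n] counts this without
    choosing a dart at each vertex. *)
Lemma card_uncut : 3 * #|[pred x | uncut x]| = #|D|.
Proof.
rewrite -sum1_card big_mkcond /=; set s := \sum_x _.
have s1 : s = \sum_x (if uncut (n x) then 1 else 0).
  by rewrite /s (reindex_inj node_inj).
have s2 : s = \sum_x (if uncut (n (n x)) then 1 else 0).
  by rewrite s1 (reindex_inj node_inj).
have -> : 3 * s = s + s + s by lia.
rewrite {2}s1 {2}s2 -!big_split -sum1_card /=; apply: eq_bigr => x _.
rewrite inE /uncut /cutting !A_edge !n_cub.
by have := A_cut x; do 3![case: (A _)].
Qed.

(** Euler's formula for a cubic map, where [V = D/3] and [E = D/2]. *)
Hypothesis card_faces : 6 * fcard f (mem (@predT D)) = #|D| + 12.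

(* One boundary cycle makes both sides connected, and Euler's formula leaves
   too few dual edges for a cycle on either side. *)
Lemma single_boundary_tree : single_boundary ->
  [/\ forall x y, A x = A y -> connect (dual_step uncut) x y &
      forall z, uncut z -> ~~ connect (dual_step (uncut_without z)) z (e z)].
Proof.
move=> single; have s := dual_step_sym uncut_edge.
have conn x y : A x = A y -> connect (dual_step uncut) x y.
  move=> Axy; apply: connect_trans (dual_step_to_cutting x) _.
  rewrite s; apply: connect_trans (dual_step_to_cutting y) _; rewrite s.
  have := cutting_to x; have := cutting_to y.
  have := A_to_cutting x; have := A_to_cutting y.
  move: (to_cutting x) (to_cutting y) => x' y' Ay' Ax' Ky' Kx'.
  have iterK k z : cutting z -> cutting (iter k boundary_next z).
    by move=> Kz; elim: k => //= k; rewrite cutting_boundary_next.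
  (* On side [A] the boundary itself is followed. On the other side the opposite darts are in [A],
     and the faces across their boundary orbit are followed. *)
  have [Ax|nAx] := boolP (A x).
    have /iter_findex <- : fconnect boundary_next x' y'.
      by apply: single; rewrite // ?Ax' ?Ay' -?Axy.
    move: (findex _ _ _) => k; elim: k => //= k IH; apply: connect_trans IH _.
    rewrite boundary_nextE ?iterK //; apply: connect_trans (dual_step_to_cutting _).
    by apply: connect1; rewrite /dual_step eqxx.
  have Aex : A (e x') by move: Kx'; rewrite /cutting Ax' (negPf nAx); case: (A _).
  have Aey : A (e y') by move: Ky'; rewrite /cutting Ay' -Axy (negPf nAx); case: (A _).
  rewrite -[x']e_inv -[y']e_inv.
  have /iter_findex <- : fconnect boundary_next (e x') (e y').
    by apply: single; rewrite ?cutting_edge.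
  move: (findex _ _ _) => k; elim: k => //= k IH; apply: connect_trans IH _.
  by apply: dual_step_boundary; rewrite iterK // cutting_edge.
split=> // z uz; apply/negP => zez.
pose P := uncut_without z; have Pe := uncut_without_edge z.
have sP := dual_step_sym Pe.
pose p := perm face_inj; pose ts := edge_list e P.
(* If the edge of [z] is not a bridge, both sides stay connected without it and [w] has at most two
   cycles. The [D/6 - 1] remaining uncut edges then allow at most [D/6 + 1] faces, but there are
   [D/6 + 2]. *)
have [|w [sub le _]] := @swap_genus D e e_inv e_fix p ts.
  exact: edge_list_selection.
have conn' x y : A x = A y -> fconnect w x y.
  move=> /conn xy; apply: sub; apply: connect_sub xy => a b ab.
  have abP : connect (dual_step P) a b.
    case/orP: ab => [/eqP->|/andP[/eqP-> ua]].
      by apply: connect1; rewrite /dual_step eqxx.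
    have [->|az] := eqVneq a z; first by [].
    have [->|aez] := eqVneq a (e z); first by rewrite e_inv sP.
    by apply: connect1; rewrite /dual_step /P /uncut_without az aez eqxx -/(uncut a) ua orbT.
  apply: connect_sub abP => c d; rewrite /dual_step => h; apply: connect1.
  by rewrite /edge_step edge_listP // permE.
have w2 : #|porbits w| <= 2.
  pose b := e (to_cutting z).
  have Ab : A z != A b by rewrite -A_to_cutting; apply: cutting_to.
  have: porbits w \subset [set porbit w z; porbit w b].
    apply/subsetP => _ /imsetP[x _ ->]; rewrite !inE !eq_porbit_mem !mem_porbitE.
    have [/conn' ->//|Ax] := eqVneq (A z) (A x).
    by rewrite orbC conn' //; move: Ab Ax; do 3![case: (A _)].
  by move/subset_leq_card => h; apply: leq_trans h _; rewrite cards2; case: (_ != _).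
have szP := size_edge_list e_inv e_fix Pe.
have cU := card_uncut.
have : #|[pred x | uncut x]| = #|[pred x | P x]| + 2.
  rewrite (cardD1 z) (cardD1 (e z)) !inE uncut_edge uz e_fix addnA addnC.
  congr (_ + _); apply: eq_card => x; rewrite !inE /P /uncut_without /uncut.
  by rewrite andbA andbC [(x != z) && _]andbC.
move: le card_faces; rewrite (fcard_perm face_inj) -/p -/ts in szP *.
rewrite -/P in szP.
move: szP w2 cU; move: #|[pred x | P x]| #|porbits p| #|porbits w| #|[pred x | uncut x]|; lia.
Qed.

End Cut.
End CubicMap.

(** * Two faces share at most one edge *)

Section Barnette.
Variables (D : finType) (e n f : D -> D).
Hypothesis e_inv : forall x, e (e x) = x.
Hypothesis e_fix : forall x, e x != x.
Hypothesis n_cub : forall x, n (n (n x)) = x.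
Hypothesis n_fix : forall x, n x != x.
Hypothesis fE : forall x, f x = n (n (e x)).
Hypothesis card_faces : 6 * fcard f (mem (@predT D)) = #|D| + 12.
Hypothesis card_vertices : 3 * fcard n (mem (@predT D)) = #|D|.
Hypothesis map_connected : forall x y, connect (graph_rel e n) x y.
Hypothesis loopless : forall x, ~~ fconnect n x (e x).
Hypothesis conn3 : three_connected e n.

Let f_inj : injective f := face_inj e_inv n_cub fE.
Let n_inj : injective n := node_inj n_cub.
Let f_e x : f (e x) = n (n x). Proof. by rewrite fE e_inv. Qed.
Let n_f x : n (f x) = e x. Proof. by rewrite fE n_cub. Qed.

(** One boundary cycle makes both sides trees, and the tree on the other side gives the single cycle
    as seen from there. *)
Lemma single_boundaryC (A : pred D) :
  (forall x, A (f x) = A x) ->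
  (forall x, ~~ ((A x == A (n x)) && (A (n x) == A (n (n x))))) ->
  single_boundary e f A -> single_boundary e f (fun x => ~~ A x).
Proof.
move=> Af Ac /(single_boundary_tree e_inv e_fix n_cub fE Af Ac card_faces).
case=> conn bridge; have cE x : cutting e (fun y => ~~ A y) x = cutting e A x.
  by rewrite /cutting; do 2![case: (A _)].
apply: (face_tree_single e_inv e_fix n_cub fE).
- by move=> x; rewrite Af.
- by move=> x; have := Ac x; do 3![case: (A _)].
split=> [x y nAx nAy|z _ uz].
  rewrite (@eq_connect _ _ (dual_step e f (uncut e A))); last first.
    by move=> a b; rewrite /dual_step /uncut cE.
  by apply: conn; rewrite (negPf nAx) (negPf nAy).
rewrite (@eq_connect _ _ (dual_step e f (uncut_without e A z))); last first.
  by move=> a b; rewrite /dual_step /uncut_without cE.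
by apply: bridge; rewrite /uncut -cE.
Qed.

Lemma other_dart u t : exists d, [/\ fconnect n u d, d != u & d != t].
Proof.
have n2 : n (n u) != u by apply: contraTneq (n_fix u) => n2; rewrite -{1}n2 n_cub eqxx.
have [nt|] := eqVneq (n u) t; last by exists (n u); rewrite fconnect1 n_fix.
exists (n (n u)); rewrite -nt n2 (inj_eq n_inj) n_fix; split=> //.
by rewrite -!(same_fconnect1_r n_inj) connect0.
Qed.

(** [W] is a union of vertices that only the edges of [u] and [v] can leave. If the edge of [u]
    does, deleting one end of each crossing edge separates the graph, against 3-connectivity. *)
Lemma no_2_edge_cut (W : pred D) u v :
  (forall x, W (n x) = W x) ->
  (forall z, z \notin [:: u; e u; v; e v] -> W (e z) = W z) ->
  W u = W (e u).
Proof.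
move=> Wn We; apply/eqP; apply: contraT => cru.
wlog Wu : u cru We / W u.
  move=> H; have [Wu|nWu] := boolP (W u); first exact: (H u).
  apply: (H (e u)); rewrite ?e_inv 1?eq_sym //.
    by move=> z; rewrite !inE orbCA => h; apply: We; rewrite !inE.
  by move: cru; rewrite (negPf nWu); case: (W _).
have Weu : W (e u) = false by move: cru; rewrite Wu; case: (W _).
have Wc x y : fconnect n x y -> W x = W y by apply: connect_invariant => a b /eqP <-.
have sn := fconnect_sym n_inj.
have away x d : fconnect n x d -> ~~ fconnect n x (e d).
  by move=> xd; apply: contra (loopless d); apply: connect_trans; rewrite sn.
have [crv|crv] := eqVneq (W v) (W (e v)).
  have We' z : z != u -> z != e u -> W (e z) = W z.
    move=> zu zeu; have [->|zv] := eqVneq z v; first by [].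
    have [->|zev] := eqVneq z (e v); first by rewrite e_inv.
    by apply: We; rewrite !inE !negb_or zu zeu zv zev.
  have [d [ud du _]] := other_dart u u.
  have deu : d != e u by apply: contraTneq ud => ->; apply: loopless.
  case: conn3 => _ /(_ u u (e d) (e u)); rewrite !orbb away // (negPf (loopless u)).
  move=> /(_ isT isT)/(@connect_invariant _ _ W) H.
  suff : W (e d) = W (e u) by rewrite We' // -(Wc _ _ ud) Wu Weu.
  apply: H => a b; rewrite !orbb => /and3P[ua ub /orP[/eqP->|/eqP bE]]; first by rewrite Wn.
  rewrite bE We' //; first by apply: contraNneq ua => ->.
  by apply: contraNneq ub => aE; rewrite bE aE e_inv.
wlog Wv : v crv We / W v.
  move=> H; have [Wv|nWv] := boolP (W v); first exact: (H v).
  apply: (H (e v)); rewrite ?e_inv 1?eq_sym //.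
    move=> z; rewrite !inE => h; apply: We; rewrite !inE.
    by rewrite [(z == v) || _]orbC.
  by move: crv; rewrite (negPf nWv); case: (W _).
have Wev : W (e v) = false by move: crv; rewrite Wv; case: (W _).
(* The deleted vertices are that of [u], inside [W], and that of [e v], outside. The darts [d] and
   [d'] at them lead to neighbours, so each side keeps a vertex. *)
have [d [ud du dv]] := other_dart u v.
have [d' [vd' d'v d'u]] := other_dart (e v) (e u).
have Wd : W d by rewrite -(Wc _ _ ud).
have Wd' : W d' = false by rewrite -(Wc _ _ vd').
have Wed : W (e d).
  rewrite We // !inE !negb_or du dv /=; apply/andP.
  by split; apply: contraTneq Wd => ->; rewrite ?Weu ?Wev.
have Wed' : W (e d') = false.
  rewrite We // !inE !negb_or; apply/and4P; split=> //.
    by apply: contraFneq Wd' => ->.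
  by apply: contraFneq Wd' => ->.
have X1 : ~~ (fconnect n u (e d) || fconnect n (e v) (e d)).
  by rewrite negb_or away //=; apply: contraFN Wev => /Wc ->.
have X2 : ~~ (fconnect n u (e d') || fconnect n (e v) (e d')).
  by rewrite negb_or (away _ _ vd') andbT; apply: contraFN Wed' => /Wc <-.
case: conn3 => _ /(_ u (e v) (e d) (e d') X1 X2)/(@connect_invariant _ _ W) H.
suff : W (e d) = W (e d') by rewrite Wed Wed'.
apply: H => a b /and3P[]; rewrite !negb_or => /andP[ua va] /andP[ub vb].
case/orP=> [/eqP->|/eqP bE]; first by rewrite Wn.
rewrite bE We // !inE !negb_or; apply/and4P; split.
- by apply: contraNneq ua => ->.
- by apply: contraNneq ub => aE; rewrite bE aE e_inv.
- by apply: contraNneq vb => aE; rewrite bE aE.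
- by apply: contraNneq va => ->.
Qed.

(* Deleting two edges shared by the same two faces merges and then splits
   these faces; by the genus inequality the map falls apart. *)
Lemma shared_edge_unique x y : ~~ fconnect f x (e x) ->
  fconnect f x y -> fconnect f (e x) (e y) -> x = y.
Proof.
move=> fx xy exy; apply/eqP; apply: contraT => nxy.
have sf := fconnect_sym f_inj.
have nxey : x != e y.
  by apply: contraNneq fx => xE; rewrite sf {2}xE.
pose P : pred D := fun z => z \notin [:: x; e x; y; e y].
have Pe z : P (e z) = P z.
  rewrite /P !inE (inj_eq (can_inj e_inv)) (inj_eq (can_inj e_inv)).
  rewrite !(can2_eq e_inv e_inv) orbCA; congr (~~ (_ || (_ || _))).
  by rewrite orbC.
(* The inverse of [n] composed with all edge swaps is [f]; leaving out the edges of [x] and [y]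
   gives the faces after their deletion. *)
pose p : {perm D} := (perm n_inj)^-1%g; pose ts := edge_list e P.
have sel : edge_selection e ts by apply: edge_list_selection.
have pE z : p z = n (n z) by apply: (@perm_inj _ (perm n_inj)); rewrite permKV permE n_cub.
have [w [sub _ genus]] := swap_genus e_inv e_fix p sel.
pose q := (swap_edges e ts * p)%g; pose F := perm f_inj.
have qE : q = (tperm y (e y) * (tperm x (e x) * F))%g.
  apply/permP => z; rewrite !permM swap_edgesE // edge_listP // pE.
  rewrite permE fE /P !inE.
  have yx : y != x by rewrite eq_sym.
  have eyx : e y != x by rewrite eq_sym.
  have yex : y != e x by rewrite -(inj_eq (can_inj e_inv)) e_inv.
  have eyex : e y != e x by rewrite (inj_eq (can_inj e_inv)).
  have [->|zx] := eqVneq z x; first by rewrite /= [tperm y _ _]tpermD // tpermL e_inv.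
  have [->|zex] := eqVneq z (e x); first by rewrite /= [tperm y _ _]tpermD // tpermR.
  have [->|zy] := eqVneq z y; first by rewrite /= tpermL tpermD ?e_inv // eq_sym.
  have [->|zey] := eqVneq z (e y); first by rewrite /= tpermR tpermD // eq_sym.
  by rewrite [tperm y _ _]tpermD 1?eq_sym // tpermD // eq_sym.
have Fc a b : fconnect F a b = fconnect f a b.
  by apply: eq_fconnect => z; rewrite permE.
have c1 : #|porbits (tperm x (e x) * F)|.+1 = #|porbits F|.
  have := @card_porbits_tperm _ F x (e x); rewrite Fc fx eq_sym e_fix => /(_ isT).
  by rewrite -addnn; lia.
have c2 : #|porbits q| = #|porbits F|.
  rewrite qE -c1; have [|h1 h2] := @fconnect_tperm_merge _ F x (e x); first by rewrite Fc.
  set F' := (tperm x (e x) * F)%g in h1 h2 *.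
  have sF' := fconnect_sym (@perm_inj _ F').
  have := @card_porbits_tperm _ F' y (e y); rewrite eq_sym e_fix => /(_ isT).
  suff -> : fconnect F' y (e y) by rewrite addn0.
  apply: (@connect_trans _ _ x); first by rewrite sF' h2 ?Fc.
  by apply: connect_trans h1 _; rewrite h2 ?Fc.
(* Since [F + V = D/2 + 2] and only [D/2 - 2] edges are swapped, the genus inequality forces two
   cycles. *)
have w2 : 2 <= #|porbits w|.
  move: genus; rewrite -/q c2 /p porbitsV -(fcard_perm n_inj) -(fcard_perm f_inj).
  have szP := size_edge_list e_inv e_fix Pe.
  have : #|[pred z | P z]| + 4 = #|D|.
    have u4 : uniq [:: x; e x; y; e y].
      rewrite /= !inE !negb_or nxy nxey (inj_eq (can_inj e_inv)) nxy.
      rewrite [x == e x]eq_sym [y == e y]eq_sym !e_fix /= !andbT.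
      by apply: contraNneq nxey => <-; rewrite e_inv.
    rewrite -(cardC [pred z | P z]) -[4]/(size [:: x; e x; y; e y]) -(card_uniqP u4).
    by congr (_ + _); apply: eq_card => z; rewrite !inE /P !inE negbK.
  rewrite -/ts in szP; move: szP card_faces card_vertices.
  move: #|[pred z | P z]| #|porbits w| #|D|; lia.
have We v z : z \notin [:: x; e x; y; e y] -> fconnect w v (e z) = fconnect w v z.
  move=> Pz; apply: (same_connect_r (fconnect_sym (@perm_inj _ w))).
  rewrite (fconnect_sym (@perm_inj _ w)); apply/sub/connect1.
  by rewrite /edge_step eqxx edge_listP // /P Pz orbT.
have Wn v z : fconnect w v (n z) = fconnect w v z.
  apply: (same_connect_r (fconnect_sym (@perm_inj _ w))).
  apply/sub; apply: (@connect_trans _ _ (n (n (n z)))); last by rewrite n_cub.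
  by apply: connect1; rewrite /edge_step pE eqxx.
(* Only the two deleted edges could leave a cycle of [w], hence none does, and connectedness leaves
   a single cycle. *)
have allW v z : fconnect w v (e z) = fconnect w v z.
  have h1 := @no_2_edge_cut (fconnect w v) x y (Wn v) (We v).
  have h2 := @no_2_edge_cut (fconnect w v) y x (Wn v).
  have {}h2 : fconnect w v y = fconnect w v (e y).
    by apply: h2 => z' h; apply: We; move: h; rewrite !inE; do 4![case: (_ == _)].
  have [|] := boolP (z \in [:: x; e x; y; e y]); last exact: We.
  by rewrite !inE => /or4P[]/eqP->; rewrite ?e_inv // ?h1 // h2.
have: porbits w \subset [set porbit w x].
  apply/subsetP => _ /imsetP[z _ ->]; rewrite inE eq_porbit_mem mem_porbitE.
  have := map_connected x z; move/(@connect_invariant _ _ (fconnect w x)) => <- //.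
  by move=> a b /orP[]/eqP->; rewrite ?Wn ?allW.
by move/subset_leq_card; rewrite cards1 => /(leq_trans w2).
Qed.

End Barnette.

(** * Trees of faces *)

Section TreeTransfer.
Variables (D : finType) (e f : D -> D) (A : pred D).
Variables (V : finType) (pi : D -> V) (r : rel V) (P : {set V}).
Hypothesis e_inv : forall x, e (e x) = x.
Hypothesis f_inj : injective f.
Hypothesis dual_sym : forall Q : pred D, (forall x, Q (e x) = Q x) ->
  connect_sym (dual_step e f Q).
Hypothesis A_face : forall x, A (f x) = A x.
Hypothesis P_pi : forall v, reflect (exists2 x, A x & v = pi x) (v \in P).
Hypothesis pi_eq : forall x y, A x -> A y -> (pi x == pi y) = fconnect f x y.
Hypothesis r_pi : forall x y, A x -> A y ->
  reflect (exists a, [/\ fconnect f x a, uncut e A a & fconnect f y (e a)])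
          (r (pi x) (pi y)).
Hypothesis shared_unique : forall a b, A a -> uncut e A a ->
  fconnect f a b -> fconnect f (e a) (e b) -> a = b.
Hypothesis no_self : forall a, A a -> uncut e A a -> ~~ fconnect f a (e a).

Let A_fconnect x y : fconnect f x y -> A x = A y.
Proof. by apply: connect_invariant => a b /eqP <-; rewrite A_face. Qed.

Let A_uncut a : uncut e A a -> A (e a) = A a.
Proof. by rewrite /uncut negbK => /eqP. Qed.

Let f_dual Q : subrel (fconnect f) (connect (dual_step e f Q)).
Proof. exact: fconnect_dual_step. Qed.

Let sf := fconnect_sym f_inj.

(** If the edge of [z] is not a bridge, a detour from [z] to [e z] projects to a walk avoiding the
    pair [pi z], [pi (e z)], since two faces share only one edge. Shortened, it closes up to a
    simple cycle of [r]. *)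
Lemma tree_face_tree : is_tree P r -> face_tree e f A.
Proof.
case=> _ [connP acyc]; split=> [x y Ax Ay|z Az uz].
  have inP w : A w -> pi w \in P by move=> Aw; apply/P_pi; exists w.
  have /connectP[p] := connP _ _ (inP x Ax) (inP y Ay).
  elim: p x Ax => [|c p IH] x Ax /=.
    by move=> _ /eqP; rewrite eq_sym pi_eq // => /f_dual.
  case/andP=> /and3P[_ /P_pi[w Aw ->]] /(r_pi Ax Aw)[a [xa ua wea]] pth lst.
  apply: connect_trans (IH _ Aw pth lst); apply: connect_trans (f_dual _ xa) _.
  apply: (@connect_trans _ _ (e a)); first by apply: connect1; rewrite /dual_step eqxx ua orbT.
  by apply: f_dual; rewrite sf.
apply/negP => zez; have Aez : A (e z) by rewrite A_uncut.
pose u := pi z; pose v := pi (e z).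
pose r' : rel V := fun a b => [&& a \in P, b \in P, r a b & ((a, b) != (u, v)) && ((a, b) != (v, u))].
have lift p x : A x -> path (dual_step e f (uncut_without e A z)) x p ->
    last x p = e z -> connect r' (pi x) v.
  elim: p x => [|c p IH] x Ax /=; first by move=> _ ->.
  case/andP=> xc pth lst; have [cE|[cE /and3P[ux xz xez]]] :
      c = f x \/ (c = e x /\ uncut_without e A z x).
    by case/orP: xc => [/eqP|/andP[/eqP]]; [left|right].
    have -> : pi x = pi c by apply/eqP; rewrite pi_eq ?cE ?A_face ?fconnect1.
    by apply: IH => //; rewrite cE A_face.
  have Ac : A c by rewrite cE A_uncut.
  apply: connect_trans (IH _ Ac pth lst); apply: connect1.
  rewrite /r'; apply/and4P; split; [by apply/P_pi; exists x|by apply/P_pi; exists c| |].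
    by apply/(r_pi Ax Ac); exists x; rewrite cE !connect0.
  rewrite !xpair_eqE !pi_eq // cE.
  apply/andP; split; apply/negP => /andP[h1 h2].
    by move: xz; rewrite (shared_unique Ax ux h1 h2) eqxx.
  by move: xez; rewrite -(shared_unique Ax ux h1) ?eqxx ?e_inv.
have /connectP[p pth lst] := zez.
have /connectP[p' pth' lst'] := lift p z Az pth (esym lst).
case/shortenP: pth' lst' => q pth' uq _ lst'.
have uv : u != v by rewrite pi_eq // no_self.
have rP a b : r' a b -> r a b by case/and4P.
(* A single step would be the excluded pair; so the cycle has at least three vertices. *)
have q2 : 2 <= size q.
  case: q pth' lst' {uq} => [|c [|d q]] //=; first by move=> _ vE; rewrite vE eqxx in uv.
  by rewrite andbT => /and4P[_ _ _] /andP[h _] vE; rewrite -vE eqxx in h.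
have sub : {subset pi z :: q <= P}.
  move=> c; rewrite inE => /predU1P[->|cq]; first by apply/P_pi; exists z.
  elim: q {uq lst' q2} (pi z) pth' cq => //= d q IH b /andP[/and4P[_ dP _ _] pth'].
  by rewrite inE => /predU1P[->//|]; apply: IH pth'.
have /negP := acyc _ uq sub q2; apply.
rewrite /= rcons_path (sub_path rP) // -lst'.
by apply/r_pi => //; exists (e z); rewrite e_inv !connect0 /uncut cutting_edge.
Qed.

(** The first step of a simple cycle of [r] lifts to a dual edge and the rest to a path around that
    edge, contradicting that it is a bridge. *)
Lemma face_tree_is_tree z0 : A z0 -> face_tree e f A -> is_tree P r.
Proof.
move=> Az0 [conn bridge].
have inP w : A w -> pi w \in P by move=> Aw; apply/P_pi; exists w.
split; first by apply/set0Pn; exists (pi z0); apply: inP.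
split=> [_ _ /P_pi[x Ax ->] /P_pi[y Ay ->]|s us sP s3].
  have /connectP[p] := conn x y Ax Ay.
  elim: p x Ax => [|c p IH] x Ax /=; first by move=> _ ->.
  case/andP=> xc pth lst; have [cE|[cE ux]] : c = f x \/ (c = e x /\ uncut e A x).
    by case/orP: xc => [/eqP|/andP[/eqP]]; [left|right].
    have -> : pi x = pi c by apply/eqP; rewrite pi_eq ?cE ?A_face ?fconnect1.
    by apply: IH => //; rewrite cE A_face.
  have Ac : A c by rewrite cE A_uncut.
  apply: connect_trans (IH _ Ac pth lst); apply: connect1; rewrite !inP //=.
  by apply/r_pi => //; exists x; rewrite cE !connect0.
apply/negP; case: s us sP s3 => [|u [|v [|w s]]] // us sP _ cyc.
have /P_pi[x0 Ax0 uE] : u \in P by apply: sP; rewrite mem_head.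
have /P_pi[x1 Ax1 vE] : v \in P by apply: sP; rewrite !inE eqxx orbT.
move: cyc; rewrite [path.cycle _ _]/= => /and3P[]; rewrite {1}uE {1}vE.
case/(r_pi Ax0 Ax1)=> a [x0a ua x1ea] rvw pth.
have Aa : A a by rewrite -(A_fconnect x0a).
have Aea : A (e a) by rewrite A_uncut.
have {x0a}ua' : u = pi a by apply/eqP; rewrite uE pi_eq.
have {x1ea}va' : v = pi (e a) by apply/eqP; rewrite vE pi_eq.
pose r' : rel V := fun a b => r a b && (((a, b) != (u, v)) && ((a, b) != (v, u))).
have lift p x y : A x -> A y -> all (mem P) p -> path r' (pi x) p ->
    last (pi x) p = pi y -> connect (dual_step e f (uncut_without e A a)) x y.
  elim: p x => [|c p IH] x Ax Ay /=.
    by move=> _ _ /eqP; rewrite pi_eq // => /f_dual.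
  case/andP=> /P_pi[c' Ac' ->] allP /andP[/andP[/(r_pi Ax Ac')[b [xb ub cb]] ne] pth'] lst.
  apply: connect_trans (IH _ Ac' Ay allP pth' lst).
  have Ab : A b by rewrite -(A_fconnect xb).
  have Aeb : A (e b) by rewrite A_uncut.
  apply: connect_trans (f_dual _ xb) _.
  apply: (@connect_trans _ _ (e b)); last by apply: f_dual; rewrite sf.
  apply: connect1; rewrite /dual_step eqxx /uncut_without -/(uncut e A b) ub /=.
  apply/orP; right; case/andP: ne => ne1 ne2; apply/andP; split.
    by apply: contraNneq ne1 => ba; rewrite xpair_eqE ua' va' -ba !pi_eq // xb cb.
  apply: contraNneq ne2 => ba; have aE : a = e b by rewrite ba e_inv.
  by rewrite xpair_eqE ua' va' -ba aE !pi_eq // xb cb.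
have /negP := bridge a Aa ua; apply.
rewrite dual_sym; last exact: uncut_without_edge.
apply: (lift (w :: rcons s u)) => //.
- apply/allP => c cs; apply: sP; move: cs; rewrite -rcons_cons mem_rcons !inE.
  by case/orP=> [->//|->]; rewrite !orbT.
- rewrite -va' /=; move: us => /= /and3P[]; rewrite !inE !negb_or.
  case/and3P=> uv uw us /andP[vw vs] /andP[ws _]; apply/andP; split.
    by rewrite /r' rvw !xpair_eqE [v == u]eq_sym (negPf uv) /= eqxx eq_sym (negPf uw).
  elim: s w uw vw us vs pth {ws sP rvw} => [|d s IH] w uw vw us vs.
    rewrite /= !andbT /r' !xpair_eqE => ->.
    by rewrite [w == u]eq_sym (negPf uw) [w == v]eq_sym (negPf vw).
  rewrite /= => /andP[rwd]; move: us vs; rewrite !inE !negb_or => /andP[ud us] /andP[vd vs].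
  move/(IH _ ud vd us vs) => ->; rewrite andbT /r' rwd !xpair_eqE.
  by rewrite [w == u]eq_sym (negPf uw) [w == v]eq_sym (negPf vw).
- by rewrite /= last_rcons -ua'.
Qed.

End TreeTransfer.

(** In the reduced maps kept and contracted edges alternate along a surviving face, so [skip] always
    takes two steps. *)
Lemma skip_second (D : finType) (g : D -> D) (p : pred D) x :
  p x -> ~~ p (g x) -> p (g (g x)) -> skip g p x = g (g x).
Proof.
move=> px pg pgg; have : 1 < fingraph.order g x.
  have xg : x != g x by apply: contraTneq px => ->.
  have <- : #|[set x; g x]| = 2 by rewrite cards2 xg.
  apply/subset_leq_card/subsetP => y; rewrite !inE => /orP[]/eqP->.
    exact: connect0.
  exact: fconnect1.
rewrite /skip; case: (fingraph.order g x) => [|[|m]] //= _.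
by rewrite (negPf pg) pgg.
Qed.

Lemma uniq_map_inj (T1 T2 : eqType) (g : T1 -> T2) (s : seq T1) :
  uniq [seq g x | x <- s] -> {in s &, injective g}.
Proof.
elim: s => //= a s IH /andP[na us] x y; rewrite !inE.
case/predU1P=> [->|xs] /predU1P[->|ys] // gE.
- by case/negP: na; rewrite gE map_f.
- by case/negP: na; rewrite -gE map_f.
- exact: IH.
Qed.

(** * Face colorings and reduced maps *)

Section ColoredMap.
(** The colours [j] and [k] stay abstract so that everything applies to 2, 3 and to 3, 2. *)
Variables (D : finType) (e n f : D -> D) (col : D -> nat) (j k : nat).
Hypothesis e_inv : forall x, e (e x) = x.
Hypothesis e_fix : forall x, e x != x.
Hypothesis n_cub : forall x, n (n (n x)) = x.
Hypothesis fE : forall x, f x = n (n (e x)).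
Hypothesis parallel_free : forall x y,
  fconnect n x y -> fconnect n (e x) (e y) -> x = y.
Hypothesis shared_unique : forall x y, ~~ fconnect f x (e x) ->
  fconnect f x y -> fconnect f (e x) (e y) -> x = y.
Hypothesis col_face : forall x, col (f x) = col x.
Hypothesis col_edge_neq : forall x, col (e x) != col x.
Hypothesis col_in : forall x, col x \in [:: 1; j; k].
Hypothesis col_uniq : uniq [:: 1; j; k].

Let f_inj : injective f := face_inj e_inv n_cub fE.
Let n_inj : injective n := node_inj n_cub.
Let f_e x : f (e x) = n (n x). Proof. by rewrite fE e_inv. Qed.
Let n_f x : n (f x) = e x. Proof. by rewrite fE n_cub. Qed.
Let f_en x : f (e (n x)) = x. Proof. by rewrite f_e n_cub. Qed.

Lemma col_edge x : col (e x) = col (n (n x)).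
Proof. by rewrite -f_e col_face. Qed.

Lemma colsP : j <> 1 /\ k <> 1 /\ j <> k.
Proof. by move: col_uniq; rewrite /= !inE; lia. Qed.

Lemma colP x :
  let cs := (col x, col (n x), col (n (n x))) in
  cs = (1, j, k) \/ cs = (j, k, 1) \/ cs = (k, 1, j) \/
  cs = (1, k, j) \/ cs = (k, j, 1) \/ cs = (j, 1, k).
Proof.
have ci y : col y = 1 \/ col y = j \/ col y = k.
  by have := col_in y; rewrite !inE => /or3P[]/eqP->; auto.
have cn y : col (n y) <> col y.
  move=> h; have := col_edge_neq (e (n y)).
  by rewrite e_inv h -[in col (e _)]col_face f_en eqxx.
have c3 : col (n (n x)) <> col x by move=> h; apply: (cn (n (n x))); rewrite n_cub.
move: (cn x) (cn (n x)) c3 => /=.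
case: (ci x) => [|[|]] ->; case: (ci (n x)) => [|[|]] -> //;
  case: (ci (n (n x))) => [|[|]] -> //; by tauto.
Qed.

Lemma col_sum x : col x + col (n x) + col (n (n x)) = 1 + j + k.
Proof. by case: (colP x) => [|[|[|[|[|]]]]] [-> -> ->]; lia. Qed.

(** The next vertex of a face sees the other two colours exchanged; this makes the edge types
    alternate along the face. *)
Lemma colf x : [/\ col (f x) = col x, col (n (f x)) = col (n (n x)) &
  col (n (n (f x))) = col (n x)].
Proof.
have h : col (n (f x)) = col (n (n x)) by rewrite n_f col_edge.
split=> //; have := col_face x; have := col_sum x; have := col_sum (f x).
by rewrite h; lia.
Qed.

Lemma colfconnect x y : fconnect f x y -> col y = col x.
Proof.
move=> /iter_findex <-; elim: (findex f x y) => //= m IH.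
by rewrite col_face.
Qed.

Lemma shared_edge_eq x y : fconnect f x y -> fconnect f (e x) (e y) -> x = y.
Proof.
by apply: shared_unique; apply: contraNN (col_edge_neq x) => /colfconnect ->.
Qed.

(** The edge of [x] separates the faces of [x] and [n (n x)], so it avoids colour [c] exactly when
    the third face at the vertex has it. *)
Lemma keepcE c x : c \in [:: 1; j; k] -> keepc e col c x = (col (n x) == c).
Proof.
rewrite /keepc col_edge !inE; have := colsP.
by case: (colP x) => [|[|[|[|[|]]]]] [-> -> ->]; lia.
Qed.

Lemma keepc_edge c x : keepc e col c (e x) = keepc e col c x.
Proof. by rewrite /keepc e_inv andbC. Qed.

(** * Face and node permutations of a reduced map *)

Section Reduced.
Variable c : nat.
Hypothesis c_in : c \in [:: 1; j; k].
Let keep := keepc e col c.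

Lemma keep_face x : col x != c -> keep (f x) = ~~ keep x.
Proof.
move=> xc; rewrite /keep !keepcE //; have [_ -> _] := colf x.
move: c_in xc; rewrite !inE; have := colsP.
by case: (colP x) => [|[|[|[|[|]]]]] [-> -> ->]; lia.
Qed.

Lemma keep_col x : keep x -> col x != c. Proof. by case/andP. Qed.

Lemma keep_face2 x : col x != c -> keep (f (f x)) = keep x.
Proof. by move=> xc; rewrite !keep_face ?col_face // negbK. Qed.

Lemma red_faceE x : keep x -> red_face e f col c x = f (f x).
Proof.
move=> kx; have xc := keep_col kx.
by apply: skip_second; rewrite // -/keep ?keep_face2 ?keep_face ?kx.
Qed.

Lemma red_nodeE x : keep x -> red_node e f col c x = n (e (n x)).
Proof.
move=> kx; have xc := keep_col kx.
have fv : finv f =1 (fun y => e (n y)) by apply: finv_eq_can => y; rewrite n_f e_inv.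
have c1 : col (e (n x)) != c by rewrite -col_face f_en.
have c2 : col (e (n (e (n x)))) != c by rewrite -col_face f_en.
have k1 : ~~ keep (e (n x)) by rewrite -keep_face // f_en.
have k2 : keep (e (n (e (n x)))).
  by rewrite -[keep _]negbK -keep_face // f_en.
by rewrite /red_node skip_second // ?fv ?e_inv.
Qed.

Lemma fconnect_red_face x y : keep x ->
  fconnect (red_face e f col c) x y = keep y && fconnect f x y.
Proof.
move=> kx; have xc := keep_col kx; apply/idP/idP.
  move/iter_findex <-; elim: (findex _ x y) => [|m /andP[km IH]].
    by rewrite /= kx connect0.
  rewrite iterS red_faceE // keep_face2 ?keep_col // km.
  by rewrite -!(same_fconnect1_r f_inj).
case/andP=> ky /iter_findex yE; move: ky; rewrite -yE; move: (findex _ _ _) => m.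
have kit i : keep (iter i f x) = ~~ odd i.
  elim: i => [|i IH] //=; rewrite keep_face ?IH //.
  by rewrite (colfconnect (fconnect_iter _ _ _)).
have itE i : iter i.*2 f x = iter i (red_face e f col c) x.
  elim: i => //= i <-; rewrite red_faceE // kit odd_double //.
rewrite kit => om; rewrite -[m]odd_double_half (negPf om) add0n itE.
exact: fconnect_iter.
Qed.

(** [n] carries the reduced node permutation to [f] on the contracted face: a kept dart [y] hangs at
    the dart [n y] of that face. *)
Lemma keep_red_node x : keep x ->
  keep (red_node e f col c x) /\ n (red_node e f col c x) = f (n x).
Proof.
move=> kx; rewrite red_nodeE //.
have nE : n (n (e (n x))) = f (n x) by rewrite fE.
by split=> //; move: kx; rewrite /keep !keepcE // nE col_face.
Qed.

Lemma fconnect_red_node x y : keep x ->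
  fconnect (red_node e f col c) x y = keep y && fconnect f (n x) (n y).
Proof.
move=> kx; have it m : keep (iter m (red_node e f col c) x) /\
    n (iter m (red_node e f col c) x) = iter m f (n x).
  by elim: m => //= m [km <-]; apply: keep_red_node.
apply/idP/idP => [/iter_findex <-|/andP[ky /iter_findex h]].
  by have [-> ->] := it (findex (red_node e f col c) x y); rewrite fconnect_iter.
suff -> : y = iter (findex f (n x) (n y)) (red_node e f col c) x by apply: fconnect_iter.
by apply: n_inj; have [_ ->] := it (findex f (n x) (n y)); rewrite h.
Qed.

End Reduced.

(** * Sides compatible with the colours, and the radial graph *)

Definition two_sided (A : pred D) : Prop :=
  [/\ forall x, A (f x) = A x, forall x, col x = j -> A x &
      forall x, col x = k -> ~~ A x].

Lemma two_sided_cut A : two_sided A ->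
  forall x, ~~ ((A x == A (n x)) && (A (n x) == A (n (n x)))).
Proof.
case=> _ Aj Ak x; apply/negP => /andP[/eqP E1 /eqP E2].
have Ex a b : col a = j -> col b = k -> A a = A b -> False.
  by move=> /Aj -> /Ak/negPf ->.
case: (colP x) => [|[|[|[|[|]]]]] [c1 c2 c3].
- exact: Ex c2 c3 E2.
- exact: Ex c1 c2 E1.
- by apply: Ex c3 c1 _; rewrite E1 E2.
- by apply: Ex c3 c2 _; rewrite E2.
- by apply: Ex c2 c1 _; rewrite E1.
- by apply: Ex c1 c3 _; rewrite E1.
Qed.

Lemma two_sided_col A x : two_sided A -> A x -> col x = 1 \/ col x = j.
Proof.
case=> _ _ Ak Ax; have := col_in x; rewrite !inE => /or3P[]/eqP; auto.
by move/Ak; rewrite Ax.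
Qed.

(* The vertex of the radial graph of the j-reduced map that stands for the face
   of [x]: a kept dart [y] sits at the reduced vertex that is the contracted
   j-face of [n y]. *)
Definition face_key (x : D) : bool * {set D} :=
  if col x == 1 then (true, [set y | keepc e col j y && fconnect f x y])
  else (false, [set y | keepc e col j y && fconnect f x (n y)]).

Definition side_faces (A : pred D) : {set D} :=
  [set x | [&& keepc e col j x, col x == 1 & A x]].

Lemma j_in : j \in [:: 1; j; k]. Proof. by rewrite !inE eqxx orbT. Qed.

Lemma keepj x : keepc e col j x = (col (n x) == j).
Proof. exact: keepcE j_in. Qed.

Lemma face_key_eq A x y : two_sided A -> A x -> A y ->
  (face_key x == face_key y) = fconnect f x y.
Proof.
move=> tA Ax Ay; have sf := fconnect_sym f_inj; apply/eqP/idP; last first.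
  move=> xy; rewrite /face_key (colfconnect xy).
  have eq z : fconnect f x z = fconnect f y z.
    exact: (same_connect sf).
  by case: ifP => _; congr (_, _); apply/setP => z; rewrite !inE eq.
have cx := two_sided_col tA Ax; have cy := two_sided_col tA Ay.
rewrite /face_key; case: eqP => x1; case: eqP => y1 //= [] /setP.
  (* A 1-face is recovered from its key through a kept dart, [x] or else the one after it. *)
  pose z := if keepc e col j x then x else f x.
  have kz : keepc e col j z.
    rewrite /z; case: ifP => // kx; rewrite keep_face ?kx ?j_in //.
    by have := colsP; lia.
  have xz : fconnect f x z by rewrite /z; case: ifP; rewrite ?fconnect1 ?connect0.
  move/(_ z); rewrite !inE kz xz /= => /esym yz.
  by apply: connect_trans xz _; rewrite sf.
(* A j-face is recovered through the kept dart [n (n x)], which hangs at [x]. *)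
move/(_ (n (n x))); rewrite !inE keepj n_cub connect0 andbT.
by case: cx => // ->; rewrite eqxx sf => /esym.
Qed.

(** Side [A] has only 1-faces and j-faces, so an uncut edge inside it joins one of each, as the
    radial graph does. A kept dart [z] in both keys points to the shared edge, that of [n z]. *)
Lemma radial_face_key A x y : two_sided A -> A x -> A y ->
  reflect (exists a, [/\ fconnect f x a, uncut e A a & fconnect f y (e a)])
          (radial_rel (face_key x) (face_key y)).
Proof.
move=> tA Ax Ay; have sf := fconnect_sym f_inj.
have cs := colsP; have [Af Aj Ak] := tA.
have Ac u v : fconnect f u v -> A u = A v.
  by apply: connect_invariant => a b /eqP <-; rewrite Af.
have cA := two_sided_col tA.
apply: (iffP andP) => [[]|[a [xa ua yea]]].
  rewrite /face_key.
  have [x1|x1] := eqVneq (col x) 1; have [y1|y1] := eqVneq (col y) 1 => //= _ /set0Pn[z].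
    rewrite !inE => /andP[/andP[kz xz] /andP[_ yz]].
    exists (e (n z)); rewrite e_inv yz; split=> //.
      by rewrite (same_fconnect1_r f_inj) f_en.
    by rewrite /uncut /cutting e_inv -Af f_en negbK -(Ac _ _ xz) -(Ac _ _ yz) Ax Ay.
  rewrite !inE => /andP[/andP[kz xz] /andP[_ yz]].
  exists (n z); rewrite xz; split=> //.
    by rewrite /uncut /cutting -[A (e _)]Af f_en negbK -(Ac _ _ xz) -(Ac _ _ yz) Ax Ay.
  by rewrite (same_fconnect1_r f_inj) f_en.
have cx := colfconnect xa; have cy := colfconnect yea.
have := cA _ Ax; have := cA _ Ay; have := col_edge_neq a.
rewrite /face_key.
have [x1|x1] := eqVneq (col x) 1; have [y1|y1] := eqVneq (col y) 1 => /= h1 h2 h3; try lia.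
  split=> //; apply/set0Pn; exists (f a); rewrite !inE keepj n_f.
  by rewrite -(same_fconnect1_r f_inj) xa yea !andbT; apply/andP; split; lia.
split=> //; apply/set0Pn; exists (f (e a)); rewrite !inE keepj n_f e_inv.
by rewrite -(same_fconnect1_r f_inj) xa yea !andbT; apply/andP; split; lia.
Qed.

Definition radial_vertices (T : {set D}) : {set bool * {set D}} :=
  [set v : bool * {set D} |
     if v.1 then [exists x in T, v.2 == orbit_set (red_face e f col j) x]
     else [exists x, keepc e col j x && (v.2 == orbit_set (red_node e f col j) x)]].

Lemma radial_verticesP A v : two_sided A ->
  reflect (exists2 x, A x & v = face_key x) (v \in radial_vertices (side_faces A)).
Proof.
move=> tA; have [Af Aj Ak] := tA; have cs := colsP; have cA := two_sided_col tA.
have rf x : keepc e col j x -> orbit_set (red_face e f col j) x =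
    [set y | keepc e col j y && fconnect f x y].
  by move=> kx; apply/setP => y; rewrite !inE fconnect_red_face ?j_in.
have rn x : keepc e col j x -> orbit_set (red_node e f col j) x =
    [set y | keepc e col j y && fconnect f (n x) (n y)].
  by move=> kx; apply/setP => y; rewrite !inE fconnect_red_node ?j_in.
rewrite inE; case: v => [[] S] /=; apply: (iffP existsP).
- case=> x /andP[]; rewrite inE => /and3P[kx x1 Ax] /eqP ->; exists x => //.
  by rewrite /face_key x1 rf.
- case=> x Ax; rewrite /face_key; case: ifP => // x1 [->].
  pose z := if keepc e col j x then x else f x.
  have kz : keepc e col j z.
    rewrite /z; case: ifP => // kx; rewrite keep_face ?kx ?j_in //.
    by move/eqP: x1; lia.
  have xz : fconnect f x z by rewrite /z; case: ifP; rewrite ?fconnect1 ?connect0.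
  exists z; rewrite inE kz (colfconnect xz) x1 rf // /=.
  rewrite /z [A _]fun_if Af if_same Ax /=.
  apply/eqP/setP => y; rewrite !inE; congr (_ && _); rewrite -/z.
  exact: (same_connect (fconnect_sym f_inj)).
- case=> x /andP[kx /eqP ->]; exists (n x); first by apply/Aj/eqP; rewrite -keepj.
  rewrite rn // /face_key; move: kx; rewrite keepj => /eqP ->.
  by have /eqP/negPf -> : j <> 1 by case: cs.
- case=> x Ax; rewrite /face_key; case: eqP => // x1 [->].
  exists (n (n x)); have kx : keepc e col j (n (n x)).
    by rewrite keepj n_cub; case: (cA _ Ax) => // ->.
  by rewrite kx rn // n_cub eqxx.
Qed.

Lemma tree_of_side A z0 : two_sided A -> A z0 ->
  is_tree (radial_vertices (side_faces A)) (@radial_rel D) <-> face_tree e f A.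
Proof.
move=> tA Az0; have [Af _ _] := tA.
have ds Q := @dual_step_sym D e n f e_inv n_cub fE Q.
have ns a : A a -> uncut e A a -> ~~ fconnect f a (e a).
  by move=> _ _; apply: contraNN (col_edge_neq a) => /colfconnect->.
have Pp v := @radial_verticesP A v tA.
have pe x y := @face_key_eq A x y tA.
have rp x y := @radial_face_key A x y tA.
have su a b (_ : A a) (_ : uncut e A a) := @shared_edge_eq a b.
split.
  exact: (tree_face_tree e_inv f_inj Af Pp pe rp su ns).
exact: (face_tree_is_tree e_inv f_inj ds Af Pp pe rp Az0).
Qed.

(* The pivot of all the equivalences: the j-faces lie on one side, the k-faces
   on the other, and the boundary between the sides is a single cycle. *)
Definition side_boundary : Prop := exists2 A, two_sided A & single_boundary e f A.

(** * Single boundaries and spanning trees of faces *)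

Lemma exists_col c (o : D) : c \in [:: 1; j; k] -> exists x, col x = c.
Proof.
have [c1|c1] := eqVneq (col o) c; first by exists o.
have [c2|c2] := eqVneq (col (n o)) c; first by exists (n o).
have [c3|c3] := eqVneq (col (n (n o))) c; first by exists (n (n o)).
move: c1 c2 c3; rewrite !inE.
by case: (colP o) => [|[|[|[|[|]]]]] [-> -> ->]; lia.
Qed.

Lemma exists_keep c d (o : D) : c \in [:: 1; j; k] -> d \in [:: 1; j; k] ->
  c != d -> exists2 x, col x = c & keepc e col d x.
Proof.
move=> ci di cd; have [x xc] := exists_col o ci.
have [kx|kx] := boolP (keepc e col d x); first by exists x.
by exists (f x); rewrite ?col_face // keep_face // xc.
Qed.

(** A j-face with no 1-face of [A] around it would, by connectedness, be the only face of [A]. Any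
    1-face would then meet j-faces in just one edge and be bounded by two parallel edges. *)
Lemma side_faces_cover A (o : D) : two_sided A -> face_tree e f A ->
  forall y, keepc e col j y ->
  exists2 z, fconnect (red_node e f col j) y z & z \in side_faces A.
Proof.
move=> tA [conn _] y ky; have [Af Aj Ak] := tA; have cs := colsP.
have sf := fconnect_sym f_inj.
case: (pickP (fun z => fconnect (red_node e f col j) y z && (z \in side_faces A))).
  by move=> z /andP[? ?]; exists z.
move=> none; pose u := n y; have cu : col u = j by apply/eqP; rewrite -keepj.
have inner a : uncut e A a -> ~~ fconnect f u a.
  move=> ua; apply/negP => fa; have ca : col a = j by rewrite (colfconnect fa).
  have Aea : A (e a) by move: ua; rewrite /uncut negbK => /eqP <-; apply: Aj.
  have cea : col (e a) = 1.
    by case: (two_sided_col tA Aea) => // h; have := col_edge_neq a; rewrite h ca eqxx.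
  have nz : n (f (e a)) = a by rewrite n_f e_inv.
  have kz : keepc e col j (f (e a)) by rewrite keepj nz ca.
  have := none (f (e a)); rewrite fconnect_red_node ?j_in // nz kz fa.
  by rewrite inE kz col_face cea Af Aea.
have stay x : A x -> fconnect f u x.
  move=> Ax; have := conn u x (Aj _ cu) Ax.
  move/(@connect_invariant _ _ (fconnect f u)) => <- //.
  move=> a b /orP[/eqP->|/andP[/eqP-> ua]]; first by rewrite -(same_fconnect1_r f_inj).
  have uea : uncut e A (e a) by rewrite /uncut cutting_edge.
  by rewrite (negPf (inner _ ua)) (negPf (inner _ uea)).
have ki : k \in [:: 1; j; k] by rewrite !inE eqxx !orbT.
have [x x1 kx] : exists2 x, col x = 1 & keepc e col k x.
  by apply: exists_keep => //; lia.
have kxx : keepc e col k (f (f x)) by rewrite keep_face2 // x1; lia.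
have ce z : col z = 1 -> keepc e col k z -> A (e z).
  move=> z1; rewrite keepcE // => /eqP zk; apply: Aj; rewrite col_edge.
  by have := col_sum z; lia.
have xE : x = f (f x).
  apply: shared_edge_eq; first by rewrite -!(same_fconnect1_r f_inj) connect0.
  apply: (@connect_trans _ _ u); first by rewrite sf stay // ce.
  by rewrite stay // ce ?col_face.
have := col_edge_neq (f x); rewrite -{1}n_f.
suff xef : x = e (f x) by rewrite n_f -xef col_face eqxx.
apply: parallel_free; first by rewrite -n_f -xE fconnect1.
by rewrite e_inv -n_f (fconnect_sym n_inj) fconnect1.
Qed.

Lemma side_boundary_tree (o : D) :
  6 * fcard f (mem (@predT D)) = #|D| + 12 -> side_boundary ->
  exists T, spanning_tree_of_faces (keepc e col j) e
    (red_node e f col j) (red_face e f col j) T /\ (forall x, x \in T -> col x = 1).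
Proof.
move=> card_faces [A tA single]; have [Af Aj Ak] := tA.
have Acut := two_sided_cut tA.
have [conn bridge] := single_boundary_tree e_inv e_fix n_cub fE Af Acut card_faces single.
have ft : face_tree e f A by split=> [x y Ax Ay|z _]; [apply: conn; rewrite Ax Ay|apply: bridge].
have [z0 /Aj Az0] := exists_col o j_in.
exists (side_faces A); split; last by move=> x; rewrite inE => /and3P[_ /eqP].
split.
- by move=> x; rewrite inE => /andP[].
- move=> x; rewrite !inE => /and3P[kx x1 Ax].
  by rewrite red_faceE ?j_in // keep_face2 ?j_in ?(keep_col kx) // kx !col_face x1 !Af.
- move=> x; rewrite !inE => /and3P[_ /eqP x1 _] /and3P[_ /eqP ex1 _].
  by have := col_edge_neq x; rewrite x1 ex1.
- exact: side_faces_cover.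
- exact/(tree_of_side tA Az0).
Qed.

Lemma tree_side_boundary (o : D) T :
  spanning_tree_of_faces (keepc e col j) e
    (red_node e f col j) (red_face e f col j) T ->
  (forall x, x \in T -> col x = 1) -> side_boundary.
Proof.
case=> Tk Tf _ _ tree T1; have cs := colsP; have sf := fconnect_sym f_inj.
have Tc x y : x \in T -> fconnect (red_face e f col j) x y -> y \in T.
  by move=> xT /iter_findex <-; elim: (findex _ x y) => //= m; apply: Tf.
have T2 x : col x = 1 -> (f (f x) \in T) = (x \in T).
  move=> x1; have xj : col x != j by lia.
  have fx : fconnect f x (f (f x)) by rewrite -!(same_fconnect1_r f_inj) connect0.
  apply/idP/idP => xT; have kx : keepc e col j _ := Tk _ xT; apply: Tc xT _.
    rewrite fconnect_red_face ?j_in // sf fx andbT.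
    by rewrite keep_face2 ?j_in // in kx.
  by rewrite fconnect_red_face ?j_in // keep_face2 ?j_in // kx.
(* [T] holds only kept darts, every second dart of its faces, hence the test on both [x] and
   [f x]. *)
pose A : pred D := fun x => (col x == j) || ((col x == 1) && ((x \in T) || (f x \in T))).
have tA : two_sided A.
  split=> [x|x xj|x xk]; rewrite /A ?col_face.
  - by congr (_ || _); case: eqP => //= x1; rewrite T2 // orbC.
  - by rewrite xj eqxx.
  - by rewrite xk; lia.
have TE : side_faces A = T.
  apply/setP => x; rewrite inE; apply/and3P/idP => [[kx x1]|xT].
    rewrite /A; case/orP=> [xj|/andP[_ /orP[//|fxT]]]; first by lia.
    have : keepc e col j (f x) := Tk _ fxT.
    by rewrite keep_face ?j_in ?kx //; lia.
  have kx : keepc e col j x := Tk _ xT.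
  by rewrite /A xT kx T1 // eqxx orbT.
have [z0 z0j] := exists_col o j_in.
have Az0 : A z0 by rewrite /A z0j eqxx.
exists A => //; apply: (face_tree_single e_inv e_fix n_cub fE).
- by case: tA.
- exact: two_sided_cut.
- by apply/(tree_of_side tA Az0); rewrite TE.
Qed.

(** * From the boundary cycle to an A-trail *)

Lemma cuttingE A x : two_sided A -> cutting e A x = (A x != A (n (n x))).
Proof. by case=> Af _ _; rewrite /cutting -f_e Af. Qed.

Lemma i_in : 1 \in [:: 1; j; k]. Proof. by []. Qed.

Lemma keep1 x : keepc e col 1 x = (col (n x) == 1).
Proof. exact: keepcE i_in. Qed.

Lemma keep1_cutting A x : two_sided A -> keepc e col 1 x -> cutting e A x.
Proof.
move=> tA; have [_ Aj Ak] := tA; rewrite keep1 cuttingE // => /eqP x1; have cs := colsP.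
case: (colP x) => [|[|[|[|[|]]]]] [c1 c2 c3]; try lia.
  by rewrite (Aj _ c3) (negPf (Ak _ c1)).
by rewrite (Aj _ c1) (negPf (Ak _ c3)).
Qed.

(** Each vertex has one edge between a j-face and a k-face, always cut; the other cut edge there
    borders a 1-face. So the two kinds alternate. *)
Lemma keep1_boundary_next A x : two_sided A -> A x -> cutting e A x ->
  keepc e col 1 (boundary_next e f A x) = ~~ keepc e col 1 x.
Proof.
move=> tA Ax; have cs := colsP; have [Af Aj Ak] := tA.
rewrite /boundary_next => cx; rewrite cx; have [cf1 cf2 cf3] := colf x.
move: cx; rewrite !cuttingE // Ax Af Ax f_e => nA.
rewrite (fun_if (keepc e col 1)) !keep1 n_cub cf1 cf2.
have := @Aj (n (n (f x))); have := @Ak (n (n (f x))); rewrite cf3.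
have := @Aj (n (n x)); have := @Ak x; rewrite Ax.
case: (A (n (n x))) nA => // _; case: (A _) => /= h1 h2 h3 h4;
  case: (colP x) => [|[|[|[|[|]]]]] [c1 c2 c3];
  move: h1 h2 h3 h4; rewrite ?c1 ?c2 ?c3 => h1 h2 h3 h4;
  do ?[by move/(_ erefl): h1 | by move/(_ erefl): h2 | by move/(_ erefl): h3 | by move/(_ erefl): h4]; lia.
Qed.

(** [n (e x)] is on the 1-face at the end of [x]. The boundary passes between this face and the
    k-face if it is in [A], and between it and the j-face otherwise. *)
Lemma boundary_next2 A x : two_sided A -> col x = j -> keepc e col 1 x ->
  boundary_next e f A (boundary_next e f A x) =
  if A (n (e x)) then n (e (n (e x))) else f (f x).
Proof.
move=> tA xj kx; have [Af Aj Ak] := tA; have cs := colsP.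
have Ax := Aj _ xj; have cx := keep1_cutting tA kx.
have cut_b y : cutting e A (boundary_next e f A y) = cutting e A y.
  exact: (cutting_boundary_next e_inv n_cub fE Af (two_sided_cut tA)).
have nnf y : n (n (f y)) = n (e y) by rewrite n_f.
have cfx : cutting e A (f x) = ~~ A (n (e x)).
  by rewrite cuttingE // Af Ax nnf; case: (A _).
have [x1 x2] : col (n x) = 1 /\ col (n (n x)) = k.
  by move: kx; rewrite keep1 => /eqP h; split=> //; have := col_sum x; lia.
rewrite {2}/boundary_next cx cfx; case: ifPn => [nA|]; rewrite /boundary_next.
  rewrite (negPf nA) cfx nA.
  suff -> : cutting e A (f (f x)) by [].
  by apply: (keep1_cutting tA); rewrite keep_face2 ?i_in //; lia.
rewrite negbK => Anx; rewrite Anx.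
have zE : f (e (f x)) = n (e x) by rewrite f_e nnf.
rewrite zE; set z := n (e x) in zE Anx *.
have cz : cutting e A z.
  by rewrite -zE; have := cut_b x; rewrite cx /boundary_next cx cfx Anx.
rewrite cz; suff -> : cutting e A (f z) = false by rewrite f_e nnf.
rewrite cuttingE // Af Anx; apply/eqP; rewrite Aj //.
have [_ _ ->] := colf z; rewrite /z -col_edge e_inv //.
Qed.

Lemma side_boundary_trail (o : D) : side_boundary ->
  exists s, A_trail (keepc e col 1) e (red_node e f col 1) (red_face e f col 1) s.
Proof.
case=> A tA single; have [Af Aj Ak] := tA; have cs := colsP.
have Acut := two_sided_cut tA; have sf := fconnect_sym f_inj.
(* Every second edge of the boundary survives the contraction, so the trail takes double steps. *)
pose bn := boundary_next e f A; pose tn x := bn (bn x).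
have bn_inj : injective bn by apply: (boundary_next_inj e_inv n_cub fE Af Acut).
have tn_inj : injective tn by move=> x y /bn_inj/bn_inj.
have bnK x : cutting e A (bn x) = cutting e A x.
  exact: (cutting_boundary_next e_inv n_cub fE Af Acut).
have bnA x : A (bn x) = A x by apply: A_boundary_next.
pose G : pred D := fun x => A x && keepc e col 1 x.
have Gj x : G x -> col x = j.
  case/andP=> Ax kx; case: (two_sided_col tA Ax) => // x1.
  by have := keep_col kx; rewrite x1.
have Gtn x : G x -> G (tn x).
  case/andP=> Ax kx; have cx := keep1_cutting tA kx.
  rewrite /G /tn !bnA Ax /bn keep1_boundary_next //.
  - by rewrite keep1_boundary_next // kx.
  - by rewrite -/bn bnA.
  - by rewrite -/bn bnK.
have [x0 x0j kx0] : exists2 x, col x = j & keepc e col 1 x.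
  by apply: exists_keep => //; [exact: j_in|lia].
have Gx0 : G x0 by rewrite /G (Aj _ x0j) kx0.
pose s := fingraph.orbit tn x0.
have sG x : x \in s = G x.
  apply/idP/idP; rewrite -fconnect_orbit.
    by move/iter_findex <-; elim: (findex _ _ _) => //= m; apply: Gtn.
  case/andP=> Ax kx; have cx := keep1_cutting tA kx.
  have cx0 := keep1_cutting tA kx0.
  have : fconnect bn x0 x by apply: single => //; apply: Aj.
  move/iter_findex => xE; move: kx; rewrite -xE; move: (findex _ _ _) => m.
  have it i : [/\ A (iter i bn x0), cutting e A (iter i bn x0) &
      keepc e col 1 (iter i bn x0) = ~~ odd i].
    elim: i => [|i [IA IK Ik]] /=; first by rewrite (Aj _ x0j).
    by rewrite bnA bnK; split=> //; rewrite keep1_boundary_next // Ik.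
  have [_ _ ->] := it m; move=> om; rewrite -[m]odd_double_half (negPf om) add0n.
  have -> : iter m./2.*2 bn x0 = iter m./2 tn x0 by elim: m./2 => //= i ->.
  exact: fconnect_iter.
have us : uniq s by apply: orbit_uniq.
have cyc : fcycle tn s by apply: cycle_orbit.
have allG : all G s by apply/allP => x; rewrite sG.
exists s; split.
- by apply/allP => x; rewrite sG => /andP[].
(* A kept edge has one dart on a j-face and one on a k-face; the trail contains just the former. *)
- move=> x kx.
  have cnt y : y \in s -> e y \notin s -> count (fun z => (z == y) || (z == e y)) s = 1.
    move=> ys eys; rewrite -[RHS]/(nat_of_bool true) -ys -(count_uniq_mem _ us).
    apply: eq_in_count => z zs /=; case: (z =P e y) => [zE|]; last by rewrite orbF.
    by rewrite -zE zs in eys.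
  have Gk y : keepc e col 1 y -> G y = (col y == j).
    move=> ky; rewrite /G ky andbT; apply/idP/eqP => [Ay|]; last exact: Aj.
    by apply: Gj; rewrite /G Ay.
  have kex : keepc e col 1 (e x) by rewrite keepc_edge.
  have cxe : (col (e x) == j) = (col x != j).
    rewrite col_edge; move: kx; rewrite keep1.
    by case: (colP x) => [|[|[|[|[|]]]]] [-> -> ->]; lia.
  have [xj|xj] := boolP (col x == j).
    by apply: cnt; rewrite sG Gk // cxe negbK.
  rewrite (eq_count (a2 := fun z => (z == e x) || (z == e (e x)))); last first.
    by move=> z /=; rewrite e_inv orbC.
  by apply: cnt; rewrite sG Gk ?e_inv // cxe.
- apply: (sub_in_cycle (P := G) (e := frel tn)) => // a b Ga Gb /eqP <-.
  have [/andP[_ kb] /andP[Aa ka]] := (Gtn _ Ga, Ga).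
  rewrite fconnect_red_node ?i_in ?keepc_edge // kb /=.
  rewrite /tn /bn boundary_next2 ?(Gj _ Ga) //; case: ifP => _.
    by rewrite -fE fconnect1.
  have -> : n (e a) = f (e (f a)) by rewrite f_e n_f.
  by rewrite sf n_f fconnect1.
- apply: (sub_in_cycle (P := G) (e := frel tn)) => // a b Ga Gb /eqP <-.
  have [/andP[_ kb] /andP[Aa ka]] := (Gtn _ Ga, Ga).
  (* Consecutive edges share the k-face of [e a] in the first case, the j-face of [a] in the
     second. *)
  apply/existsP; move: kb; rewrite /tn /bn boundary_next2 ?(Gj _ Ga) //; case: ifP => _ kb.
    exists (e (n (e (n (e a))))); rewrite keepc_edge kb connect0 orbT andbT.
    rewrite [X in _ || X]fconnect_red_face ?keepc_edge ?i_in // ka.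
    by have := fconnect_iter f 2 (e (n (e (n (e a))))); rewrite /= !f_en => ->; rewrite orbT.
  exists a; rewrite ka connect0 /= fconnect_red_face ?i_in // kb.
  by rewrite -!(same_fconnect1_r f_inj) connect0.
Qed.

(** * A-trails *)

(** Besides the contracted 1-face, [a] and [b] share a face on one side of each. The 1-face edges
    next to [a] and [b] both separate these two faces, so they coincide. Two of the four cases give
    [b = e a]. *)
Lemma trail_step a b : keepc e col 1 a -> keepc e col 1 b -> b != e a ->
  fconnect (red_node e f col 1) (e a) b ->
  on_common_face (keepc e col 1) e (red_face e f col 1) a b ->
  b = f (f a) \/ b = n (e (n (e a))).
Proof.
move=> ka kb bea; have sf := fconnect_sym f_inj.
rewrite fconnect_red_node ?i_in ?keepc_edge // => /andP[_ Pab].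
case/existsP=> z /and3P[kz]; rewrite !fconnect_red_face ?i_in // !keepc_edge ka kb /=.
have fc x y : fconnect f (f x) y = fconnect f x y by rewrite -(same_fconnect1 f_inj).
have fcr x y : fconnect f x (f y) = fconnect f x y by rewrite -(same_fconnect1_r f_inj).
have tr x y : fconnect f z x -> fconnect f z y -> fconnect f x y.
  by rewrite sf; apply: connect_trans.
have s1 c : f (e (f c)) = n (e c) by rewrite f_e n_f.
have s2 c : f (e (f (e c))) = n c by rewrite s1 e_inv.
case/orP=> za /orP[] zb; have ab := tr _ _ za zb.
- left; have -> : f a = e (n b); last by rewrite f_en.
  apply: shared_edge_eq; first by rewrite fc -fcr f_en.
  by rewrite e_inv -fc s1.
- case/eqP: bea; have /f_inj -> : f a = f (e b); last by rewrite e_inv.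
  apply: shared_edge_eq; first by rewrite fc fcr.
  by rewrite -fc -fcr s1 s2.
- case/eqP: bea; have h : e (n (e a)) = e (n b); last by rewrite -[b]f_en -h f_en.
  apply: shared_edge_eq; last by rewrite !e_inv.
  by rewrite -fc -fcr !f_en.
- right; have -> : e (n (e a)) = f (e b); last by rewrite n_f e_inv.
  apply: shared_edge_eq; first by rewrite -fc f_en fcr.
  by rewrite e_inv -fcr s2.
Qed.

Lemma trail_step_col a : col (n (e (n (e a)))) = col a.
Proof.
have := colf (e (n (e a))); rewrite f_en => -[_ _ <-].
by rewrite -col_edge e_inv.
Qed.

Section Trail.
Variable s : seq D.
Hypothesis s_trail :
  A_trail (keepc e col 1) e (red_node e f col 1) (red_face e f col 1) s.

Lemma trail_keep a : a \in s -> keepc e col 1 a.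
Proof. by case: s_trail => /allP sk _ _ _ /sk. Qed.

Lemma trail_edge a : a \in s -> e a \notin s.
Proof.
move=> as_; apply/negP => eas; have [_ cnt _ _] := s_trail.
have := cnt a (trail_keep as_); rewrite -size_filter => h.
have : 2 <= size [seq y <- s | (y == a) || (y == e a)].
  apply: (@uniq_leq_size _ [:: a; e a]); first by rewrite /= inE eq_sym e_fix.
  by move=> y; rewrite !inE mem_filter => /orP[]/eqP->; rewrite eqxx ?orbT.
by rewrite h.
Qed.

Lemma trail_uniq : uniq s.
Proof.
have [_ cnt _ _] := s_trail.
have c1 x : x \in s -> count_mem x s <= 1.
  move=> xs; rewrite -(cnt x (trail_keep xs)); apply: sub_count => y /= ->//.
elim: (s) c1 => //= x s' IH c1; apply/andP; split.
  by have := c1 x (mem_head _ _); rewrite eqxx add1n ltnS leqn0 => /eqP/count_memPn.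
apply: IH => y ys; apply: leq_trans (c1 y _); last by rewrite inE ys orbT.
exact: leq_addl.
Qed.

Lemma trail_next a : a \in s ->
  next s a = f (f a) \/ next s a = n (e (n (e a))).
Proof.
move=> as_; have [_ _ c1 c2] := s_trail.
have ns : next s a \in s by rewrite mem_next.
apply: trail_step; rewrite ?trail_keep //.
- by apply: contraTneq ns => ->; apply: trail_edge.
- exact: (next_cycle c1 as_).
- exact: (next_cycle c2 as_).
Qed.

Lemma trail_connect a b : a \in s -> b \in s -> fconnect (next s) a b.
Proof. by move=> as_ bs; apply: connect_cycle as_ bs; apply: cycle_next trail_uniq. Qed.

(** Both kinds of step keep the colour, so the trail runs along j-faces only or along k-faces only;
    exchanging the colours covers the second case. *)
Lemma trail_col a b : a \in s -> b \in s -> col a = col b.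
Proof.
move=> as_ bs; have /iter_findex <- := trail_connect as_ bs.
move: (findex _ _ _) => m; suff [] : iter m (next s) a \in s /\ col a = col (iter m (next s) a) by [].
elim: m => //= m [ms ->]; rewrite mem_next; split=> //.
by case: (trail_next ms) => ->; rewrite ?col_face ?trail_step_col.
Qed.

Hypothesis s_col : forall a, a \in s -> col a = j.

Lemma mem_trail x : col x = j -> keepc e col 1 x -> x \in s.
Proof.
move=> xj kx; have [_ cnt _ _] := s_trail.
have : has (fun y => (y == x) || (y == e x)) s by rewrite has_count cnt.
case/hasP=> y ys /orP[]/eqP yE; first by rewrite -yE.
by have := col_edge_neq x; rewrite -yE s_col // xj eqxx.
Qed.

(* At the vertex of the reduced graph reached by a dart [a] of the trail, that
   is at the 1-face of [y = n (e a)], the trail either follows the j-face of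
   [a] or it does not; which one only depends on the 1-face. *)
Let follows y := next s (e (n (n y))) == f (f (e (n (n y)))).

Lemma trail_dart y : col y = 1 -> keepc e col j y -> e (n (n y)) \in s.
Proof.
rewrite keepj => y1 /eqP yj; apply: mem_trail.
  by rewrite col_edge n_cub.
by rewrite keepc_edge keep1 n_cub y1.
Qed.

(** Otherwise two darts of the trail would have the same successor. *)
Lemma follows_face2 y : col y = 1 -> keepc e col j y ->
  follows (f (f y)) -> follows y.
Proof.
move=> y1 ky; have cs := colsP; have yj : col y != j by lia.
have ks := trail_dart y1 ky.
have ks2 : e (n (n (f (f y)))) \in s.
  by apply: trail_dart; rewrite ?col_face // keep_face2 ?j_in.
rewrite /follows => /eqP h; apply: contraT => nh.
have [h'|h'] := trail_next ks; first by rewrite h' eqxx in nh.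
have : next s (e (n (n y))) = next s (e (n (n (f (f y))))).
  rewrite h h' e_inv n_cub f_e n_cub n_f.
  by rewrite f_e n_f.
move/(can_inj (prev_next trail_uniq))/(can_inj e_inv)/n_inj/n_inj => yE.
by move: nh; rewrite {1 2}yE h eqxx.
Qed.

(** A 1-face joins [A] when the trail leaves the j-face there, matching the cases of
    [boundary_next2]. *)
Let side x := (col x == j) ||
  (col x == 1) && [exists y, [&& fconnect f x y, keepc e col j y & ~~ follows y]].

Lemma sideE y : col y = 1 -> keepc e col j y -> side y = ~~ follows y.
Proof.
move=> y1 ky; have cs := colsP; have sf := fconnect_sym f_inj.
have yj : (col y == j) = false by lia.
rewrite /side yj y1 eqxx /=; apply/existsP/idP => [[z /and3P[yz kz]]|ny]; last first.
  by exists y; rewrite connect0 ky.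
have z1 : col z = 1 by rewrite (colfconnect yz).
have : fconnect (red_face e f col j) z y by rewrite fconnect_red_face ?j_in // ky sf.
move/iter_findex => <- nz; move: (findex _ _ _) => m.
suff [] : [/\ col (iter m (red_face e f col j) z) = 1,
   keepc e col j (iter m (red_face e f col j) z) &
   ~~ follows (iter m (red_face e f col j) z)] by [].
elim: m => //= m [w1 kw nw]; rewrite red_faceE ?j_in // !col_face.
split; rewrite ?keep_face2 ?j_in ?w1 //; first by lia.
by apply: contra nw; apply: follows_face2.
Qed.

Lemma trail_two_sided : two_sided side.
Proof.
have cs := colsP; split=> [x|x xj|x xk]; rewrite /side ?col_face.
- congr (_ || (_ && _)); apply: eq_existsb => y.
  by rewrite -(same_fconnect1 f_inj).
- by rewrite xj eqxx.
- by rewrite xk; lia.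
Qed.

(** Two boundary steps from a trail dart make one trail step, and every boundary dart of this side
    is on the trail or one step before it. *)
Lemma trail_side_boundary : side_boundary.
Proof.
have tA := trail_two_sided; have cs := colsP; exists side => // x y Ax Ay cx cy.
have [Af Aj Ak] := tA; have Acut := two_sided_cut tA.
pose bn := boundary_next e f side.
have bn_inj : injective bn by apply: (boundary_next_inj e_inv n_cub fE Af Acut).
have bnA z : side (bn z) = side z by apply: A_boundary_next.
have nextE a : a \in s -> bn (bn a) = next s a.
  move=> as_; have aj := s_col as_; have ka := trail_keep as_.
  have ak : col (e a) = k.
    by move: ka; rewrite keep1 col_edge; have := col_sum a; lia.
  have y1 : col (n (e a)) = 1.
    by apply/eqP; rewrite -keep1 keepc_edge.
  have ky : keepc e col j (n (e a)).
    by rewrite keepj -col_edge e_inv aj.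
  rewrite /bn boundary_next2 // sideE // /follows n_cub e_inv.
  have [->|] := eqVneq (next s a) (f (f a)); first by [].
  by case: (trail_next as_) => ->; rewrite ?eqxx.
have to_trail z : side z -> cutting e side z -> exists2 a, a \in s & fconnect bn z a.
  move=> Az cz; have Gj a : side a -> keepc e col 1 a -> a \in s.
    move=> Aa ka; apply: mem_trail => //; case: (two_sided_col tA Aa) => // a1.
    by have := keep_col ka; rewrite a1.
  have [kz|kz] := boolP (keepc e col 1 z); first by exists z; rewrite ?Gj.
  by exists (bn z); rewrite ?fconnect1 // Gj ?bnA // keep1_boundary_next.
have [a as_ xa] := to_trail x Ax cx; have [b bs yb] := to_trail y Ay cy.
apply: connect_trans xa _; rewrite (fconnect_sym bn_inj); apply: connect_trans yb _.
rewrite (fconnect_sym bn_inj); have /iter_findex <- := trail_connect as_ bs.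
move: (findex _ _ _) => m.
suff [] : iter m (next s) a \in s /\ fconnect bn a (iter m (next s) a) by [].
elim: m => //= m [ms IH]; rewrite mem_next; split=> //.
by rewrite -nextE // -!(same_fconnect1_r bn_inj).
Qed.

End Trail.

(** * Hamiltonian cycles *)

Lemma fconnect_node x y : fconnect n x y -> [\/ y = x, y = n x | y = n (n x)].
Proof.
move/iter_findex <-; elim: (findex _ _ _) => [|m IH] /=; first by constructor 1.
by case: IH => ->; rewrite ?n_cub; [constructor 2|constructor 3|constructor 1].
Qed.

(** With [out_dart_exists], this says that the boundary leaves each vertex exactly once, as a
    hamiltonian cycle must. *)
Lemma out_dart_unique A x y : two_sided A -> A x -> A y -> cutting e A x ->
  cutting e A y -> fconnect n x y -> x = y.
Proof.
move=> tA Ax Ay; rewrite !cuttingE // Ax Ay => nx ny /fconnect_node[] yE //.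
  by move: ny; rewrite yE n_cub Ax.
by move: nx; rewrite -yE Ay.
Qed.

Lemma out_dart_exists A y : two_sided A ->
  exists x, [/\ A x, cutting e A x & fconnect n y x].
Proof.
move=> tA; have fn2 : fconnect n y (n (n y)) by apply: (fconnect_iter n 2).
have := two_sided_cut tA y.
case A0: (A y); case A1: (A (n y)); case A2: (A (n (n y))) => //= _.
- by exists y; rewrite cuttingE // A0 A2.
- by exists (n (n y)); rewrite cuttingE // n_cub A1 A2.
- by exists y; rewrite cuttingE // A0 A2.
- by exists (n y); rewrite cuttingE // n_cub A0 A1 fconnect1.
- by exists (n y); rewrite cuttingE // n_cub A0 A1 fconnect1.
- by exists (n (n y)); rewrite cuttingE // n_cub A1 A2.
Qed.

(** The cycle is the boundary orbit; its edges are the cut edges, so the side of [o] is the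
    connected complement of [A]. *)
Lemma side_boundary_ham (o : D) :
  6 * fcard f (mem (@predT D)) = #|D| + 12 -> 3 < number_of_vertices n -> col o = k ->
  side_boundary -> exists s : seq D, [/\ ham_cycle e n s,
    (forall x, col x = j -> ~~ same_side e f s o x) &
    (forall x, col x = k -> same_side e f s o x)].
Proof.
move=> card_faces V3 ok [A tA single]; have [Af Aj Ak] := tA; have cs := colsP.
have Acut := two_sided_cut tA.
have [conn _] := single_boundary_tree e_inv e_fix n_cub fE Af Acut card_faces single.
pose bn := boundary_next e f A.
have bn_inj : injective bn by apply: (boundary_next_inj e_inv n_cub fE Af Acut).
have bnA x : A (bn x) = A x by apply: A_boundary_next.
have bnK x : cutting e A (bn x) = cutting e A x.
  exact: (cutting_boundary_next e_inv n_cub fE Af Acut).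
have [x0 [Ax0 cx0 _]] := out_dart_exists o tA.
pose G : pred D := fun x => A x && cutting e A x.
pose s := fingraph.orbit bn x0.
have sG x : x \in s = G x.
  apply/idP/idP; rewrite -fconnect_orbit; last by case/andP=> Ax cx; apply: single.
  move/iter_findex <-; elim: (findex _ _ _) => [|m] /=; first by rewrite /G Ax0.
  by rewrite /G bnA bnK.
have sn := fconnect_sym n_inj.
have inC x : in_cycle e s x = cutting e A x.
  rewrite /in_cycle !sG /G cutting_edge // -andb_orl.
  by rewrite /cutting; do 2![case: (A _)].
have same x : same_side e f s o x = connect (dual_step e f (uncut e A)) o x.
  by apply: eq_connect => a b; rewrite inC.
have cov y : froot n y \in [seq froot n x | x <- s].
  have [x [Ax cx yx]] := out_dart_exists y tA.
  by apply/mapP; exists x; [rewrite sG /G Ax|apply/(rootP sn)].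
exists s; split=> [|x xj|x xk]; rewrite ?same.
- split=> //.
  + rewrite -(size_map (froot n)); apply: ltnW; apply: leq_trans V3 _.
    rewrite /number_of_vertices; apply: leq_trans (card_size _); apply: subset_leq_card.
    by apply/subsetP => _ /imsetP[y _ ->]; apply: cov.
  + rewrite map_inj_in_uniq ?orbit_uniq // => x y; rewrite !sG.
    by case/andP=> Ax cx /andP[Ay cy] /(rootP sn); apply: (out_dart_unique tA).
  + have cyc : fcycle bn s by apply: cycle_orbit.
    apply: (sub_in_cycle (P := G) (e := frel bn)) cyc; last by apply/allP => x; rewrite sG.
    move=> x y /andP[_ cx] _ /eqP <-; rewrite /bn /boundary_next cx -n_f sn.
    case: ifP => _; first by rewrite fconnect1.
    by rewrite f_e -!(same_fconnect1 n_inj) fconnect1.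
- apply/negP => /(@connect_invariant _ _ A) h; move: (Ak _ ok).
  by rewrite h ?Aj // => a b; apply: A_dual_step.
- by apply: conn; rewrite (negPf (Ak _ ok)) (negPf (Ak _ xk)).
Qed.

Lemma ham_next s q : ham_cycle e n s -> q \in s ->
  fconnect n (e q) (next s q) /\
  (forall d, fconnect n (e q) d -> in_cycle e s d -> d = e q \/ d = next s q).
Proof.
case=> _ us _ cyc qs; have sn := fconnect_sym n_inj.
have us' := map_uniq us.
have atq x : x \in s -> fconnect n (e x) (next s x) by move=> xs; apply: (next_cycle cyc).
have same x y : x \in s -> y \in s -> fconnect n x y -> x = y.
  by move=> xs ys /(rootP sn); apply: (uniq_map_inj us).
split=> [|d qd]; first exact: atq.
case/orP=> [ds|eds].
  right; apply: same; rewrite ?mem_next //.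
  by apply: connect_trans (atq _ qs); rewrite sn.
left; rewrite -[d]e_inv; congr e; apply: (can_inj (prev_next us')).
apply: same; rewrite ?mem_next //.
have := atq _ eds; rewrite e_inv sn => h; apply: connect_trans h _.
by apply: connect_trans (atq _ qs); rewrite sn.
Qed.

(* The edges of the cycle are exactly those where the side changes, because
   both numbers are two at each vertex. *)
Lemma ham_single_boundary s (A : pred D) q0 : ham_cycle e n s ->
  (forall x, A (f x) = A x) ->
  (forall x, ~~ ((A x == A (n x)) && (A (n x) == A (n (n x))))) ->
  (forall x, ~~ in_cycle e s x -> A (e x) = A x) ->
  q0 \in s -> A q0 -> single_boundary e f A.
Proof.
move=> hs Af Acut Ae q0s Aq0; have sn := fconnect_sym n_inj.
have cutE x : cutting e A x = (A x != A (n (n x))) by rewrite /cutting -f_e Af.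
have inK d : cutting e A d -> in_cycle e s d.
  by move=> cd; apply: contraT => /Ae Ad; move: cd; rewrite /cutting Ad eqxx.
have nE y : n y <> y.
  by move=> ny; have := Acut y; rewrite !ny eqxx.
pose bn := boundary_next e f A.
have bnA x : A (bn x) = A x by apply: A_boundary_next.
(* The two cut edges at the end of [q] are cycle edges, and the cycle has only two there; so they
   agree. *)
have step q : q \in s -> cutting e A q /\ next s q = bn q.
  move=> qs; have [_ two] := ham_next hs qs; set y := f q.
  have eqE : e q = n y by rewrite n_f.
  rewrite eqE in two.
  have fy : fconnect n (n y) y by rewrite sn fconnect1.
  have fny : fconnect n (n y) (n (n y)) by rewrite fconnect1.
  have y_out : cutting e A y -> y = next s q.
    by move=> cy; case: (two y fy (inK _ cy)) => // h; case: (nE y).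
  have nny_out : cutting e A (n (n y)) -> n (n y) = next s q.
    by move=> cy; case: (two _ fny (inK _ cy)) => // h; case: (nE (n y)).
  have nny : n (n y) <> y by move=> h; apply: (nE (n (n y))); rewrite n_cub.
  have cq : cutting e A q.
    rewrite -(cutting_edge e_inv) eqE; apply: contraT => cny.
    have [cy cnny] : cutting e A y /\ cutting e A (n (n y)).
      move: cny (Acut y); rewrite !cutE !n_cub.
      by do 3![case: (A _)].
    by case: nny; rewrite (nny_out cnny) -(y_out cy).
  split=> //; rewrite /bn /boundary_next cq -/y; case: ifPn => cy; first by rewrite -y_out.
  rewrite f_e; apply/esym/nny_out.
  by move: cy (Acut y); rewrite !cutE !n_cub; do 3![case: (A _)].
have cycs : fcycle (next s) s by apply: cycle_next; case: hs => _ /map_uniq.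
have from0 x : x \in s -> fconnect bn q0 x.
  move=> xs; have /iter_findex <- := connect_cycle cycs q0s xs.
  move: (findex _ _ _) => m.
  suff [] : iter m (next s) q0 \in s /\ fconnect bn q0 (iter m (next s) q0) by [].
  elim: m => //= m [ms IH]; rewrite mem_next; split=> //.
  have [_ ->] := step _ ms; exact: connect_trans IH (fconnect1 _ _).
have As x : x \in s -> A x.
  move=> /from0/iter_findex <-; elim: (findex _ _ _) => //= m.
  by rewrite bnA.
have mem_s x : A x -> cutting e A x -> x \in s.
  move=> Ax cx; have [_ _ cov _] := hs.
  have /mapP[y ys /(rootP sn) xy] := cov x.
  have [cy _] := step _ ys; have Ay := As _ ys.
  move: cx cy; rewrite !cutE Ax Ay; case: (fconnect_node xy) => yE; first by rewrite -yE.
    by rewrite yE n_cub Ax.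
  by rewrite -yE Ay.
have bn_inj : injective bn by apply: (boundary_next_inj e_inv n_cub fE Af Acut).
move=> x y Ax Ay cx cy; apply: (@connect_trans _ _ q0); last exact/from0/mem_s.
by rewrite (fconnect_sym bn_inj); apply/from0/mem_s.
Qed.

Lemma ham_side_boundary s o :
  6 * fcard f (mem (@predT D)) = #|D| + 12 -> ham_cycle e n s ->
  (forall x, col x = j -> ~~ same_side e f s o x) ->
  (forall x, col x = k -> same_side e f s o x) -> side_boundary.
Proof.
move=> card_faces hs hj hk; pose A : pred D := fun x => ~~ same_side e f s o x.
have inCe x : in_cycle e s (e x) = in_cycle e s x by rewrite /in_cycle e_inv orbC.
have sd : connect_sym (dual_step e f (fun a => ~~ in_cycle e s a)).
  by apply: (dual_step_sym e_inv n_cub fE) => x; rewrite inCe.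
have Af x : A (f x) = A x.
  congr (~~ _); apply/esym/(same_connect_r sd)/connect1.
  by rewrite /dual_step eqxx.
have Ae x : ~~ in_cycle e s x -> A (e x) = A x.
  move=> nx; congr (~~ _); apply/esym/(same_connect_r sd)/connect1.
  by rewrite /dual_step eqxx nx orbT.
have tA : two_sided A by split=> // x /hk; rewrite negbK.
have Acut := two_sided_cut tA.
have [q0 q0s] : exists q0, q0 \in s.
  by case: hs; case: (s) => // q0 s' _ _ _ _; exists q0; rewrite mem_head.
(* The darts of the cycle may lie on either side of it; in the second case the boundary is single as
   seen from the complement of [A]. *)
have [Aq|nAq] := boolP (A q0); first by exists A => //; apply: ham_single_boundary q0s Aq.
pose B : pred D := fun x => ~~ A x.
have Bf x : B (f x) = B x by rewrite /B Af.
have Bcut x : ~~ ((B x == B (n x)) && (B (n x) == B (n (n x)))).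
  by have := Acut x; rewrite /B; do 3![case: (A _)].
have sB : single_boundary e f B.
  by apply: ham_single_boundary q0s nAq => // x /Ae; rewrite /B => ->.
exists (fun x => ~~ B x).
  have BB x : ~~ B x = A x by apply: negbK.
  by have [_ Aj Ak] := tA; split=> x; rewrite !BB; [apply: Af|apply: Aj|apply: Ak].
exact: (single_boundaryC e_inv e_fix n_cub fE card_faces).
Qed.

End ColoredMap.

(** * Exchanging the two sides *)

Section Swap.
Variables (D : finType) (e n f : D -> D) (col : D -> nat) (j k : nat).
Hypothesis e_inv : forall x, e (e x) = x.
Hypothesis e_fix : forall x, e x != x.
Hypothesis n_cub : forall x, n (n (n x)) = x.
Hypothesis fE : forall x, f x = n (n (e x)).
Hypothesis card_faces : 6 * fcard f (mem (@predT D)) = #|D| + 12.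
Hypothesis col_face : forall x, col (f x) = col x.
Hypothesis col_edge_neq : forall x, col (e x) != col x.
Hypothesis col_in : forall x, col x \in [:: 1; j; k].

Lemma side_boundary_swap : side_boundary e f col j k -> side_boundary e f col k j.
Proof.
case=> A tA single; have [Af Aj Ak] := tA; exists (fun x => ~~ A x).
  by split=> x; [rewrite Af|apply: Ak|rewrite negbK; apply: Aj].
apply: (single_boundaryC e_inv e_fix n_cub fE card_faces) => //.
exact: (two_sided_cut e_inv n_cub fE col_face col_edge_neq col_in tA).
Qed.
End Swap.

Theorem theorem2 (D : finType) (edge node face : D -> D) (col : D -> nat) (o : D) :
  barnette edge node face ->
  face_3_coloring edge face col ->
  col o = 3 -> (* the face of dart o is the outer face; it is a 3-face *)
  [<->
   (* (i) *)
   (exists s : seq D, [/\ ham_cycle edge node s,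
      (forall x, col x = 2 -> ~~ same_side edge face s o x) &
      (forall x, col x = 3 -> same_side edge face s o x)]);
   (* (ii) contracting the 1-faces *)
   (exists s : seq D, A_trail (keepc edge col 1) edge
      (red_node edge face col 1) (red_face edge face col 1) s);
   (* (iii) contracting the 2-faces *)
   (exists T : {set D}, spanning_tree_of_faces (keepc edge col 2) edge
      (red_node edge face col 2) (red_face edge face col 2) T
      /\ (forall x, x \in T -> col x = 1));
   (* (iv) contracting the 3-faces *)
   (exists T : {set D}, spanning_tree_of_faces (keepc edge col 3) edge
      (red_node edge face col 3) (red_face edge face col 3) T
      /\ (forall x, x \in T -> col x = 1))].
Proof.
case=> -[[e_inv e_fix] [n_inj f_inj] enf conn euler] [loopless par] cub _ conn3.
case=> col_in col_face col_edge o3.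
have n_cub x : node (node (node x)) = x.
  by have := iter_order n_inj x; rewrite cub.
have n_fix x : node x != x.
  apply/eqP => nx; have : fcycle node [:: x] by rewrite /= nx eqxx.
  by move/order_le_cycle => /(_ x (mem_head _ _)); rewrite cub.
have fE x : face x = node (node (edge x)).
  by rewrite -[in RHS](enf x) e_inv n_cub.
have cardV : fcard node (mem (@predT D)) * 3 = #|D|.
  by apply: fcard_order_set => //; apply/subsetP => x _; rewrite inE cub.
have cardE : fcard edge (mem (@predT D)) * 2 = #|D|.
  apply: (fcard_order_set (can_inj e_inv)) => //; apply/subsetP => x _; rewrite inE.
  have cx : fcycle edge [:: x; edge x] by rewrite /= e_inv !eqxx.
  by rewrite (order_cycle cx) ?mem_head //= inE eq_sym e_fix.
have cardF : 6 * fcard face (mem (@predT D)) = #|D| + 12 by lia.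
have cardV' : 3 * fcard node (mem (@predT D)) = #|D| by rewrite mulnC.
have shared := @shared_edge_unique D edge node face e_inv e_fix n_cub n_fix fE
  cardF cardV' conn loopless conn3.
have u23 : uniq [:: 1; 2; 3] by [].
have u32 : uniq [:: 1; 3; 2] by [].
have col_in' x : col x \in [:: 1; 3; 2].
  by have := col_in x; rewrite !inE; do 3![case: (_ == _)].
have swap23 : side_boundary edge face col 2 3 -> side_boundary edge face col 3 2.
  exact: (side_boundary_swap e_inv e_fix n_cub fE cardF).
have swap32 : side_boundary edge face col 3 2 -> side_boundary edge face col 2 3.
  exact: (side_boundary_swap e_inv e_fix n_cub fE cardF).
(* Every implication passes through [side_boundary]; exchanging the sides switches between colours
   2, 3 and 3, 2. *)
tfae.
- case=> s [hs h2 h3].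
  have sb : side_boundary edge face col 2 3.
    exact: (ham_side_boundary e_inv e_fix n_cub fE col_face col_edge col_in
      cardF hs h2 h3).
  exact: (side_boundary_trail e_inv n_cub fE col_face col_edge col_in u23 o sb).
- case=> s trail; have [_ cnt _ _] := trail.
  have sb : side_boundary edge face col 2 3.
    have [a as_] : exists a, a \in s.
      have [x _ kx] := exists_keep e_inv n_cub fE col_face col_edge col_in u23 o
        (isT : 2 \in [:: 1; 2; 3]) (isT : 1 \in [:: 1; 2; 3]) isT.
      have : has (fun y => (y == x) || (y == edge x)) s by rewrite has_count cnt.
      by case/hasP=> y ys _; exists y.
    have acol b : b \in s -> col b = col a.
      move=> bs; exact: (trail_col e_inv e_fix n_cub fE shared
      col_face col_edge col_in u23 trail).
    have [a2|a2] := eqVneq (col a) 2.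
      apply: (trail_side_boundary e_inv e_fix n_cub fE shared
      col_face col_edge col_in u23 trail).
      by move=> b bs; rewrite acol.
    have a3 : col a = 3.
      have [/allP sk _ _ _] := trail; have /andP[a1 _] := sk _ as_.
      by move: a1 a2 (col_in a); rewrite !inE => /negPf-> /negPf-> /eqP.
    apply: swap32.
    apply: (trail_side_boundary e_inv e_fix n_cub fE shared
      col_face col_edge col_in' u32 trail).
    by move=> b bs; rewrite acol.
  exact: (side_boundary_tree e_inv e_fix n_cub fE par shared
      col_face col_edge col_in u23 o cardF sb).
- case=> T [span T1].
  have sb := tree_side_boundary e_inv e_fix n_cub fE shared
      col_face col_edge col_in u23 o span T1.
  exact: (side_boundary_tree e_inv e_fix n_cub fE par shared
      col_face col_edge col_in' u32 o cardF (swap23 sb)).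
- case=> T [span T1].
  have sb := tree_side_boundary e_inv e_fix n_cub fE shared
      col_face col_edge col_in' u32 o span T1.
  by apply: (side_boundary_ham e_inv e_fix n_cub fE col_face col_edge
    col_in u23 cardF _ o3 (swap32 sb)); case: conn3.
Qed.
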